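(* Let $(A,\mathfrak m)$ be a coherent quasilocal ring of finite weak dimension. Then $\mathrm{Kdepth}(A)=\mathrm{w.dim}(A)\le \dim(A)$. In particular, $\mathrm{w.dim}(A)\le \mathrm{ara}(\mathfrak m)$.
   Context: All rings are commutative, not necessarily noetherian. A quasilocal ring is a ring with a unique maximal ideal. A ring is coherent if each of its finitely generated ideals is finitely presented. The weak dimension $\mathrm{w.dim}(A)$ is the supremum of the flat dimensions of all $A$-modules; $\dim$ is Krull dimension; $\mathrm{ara}(\mathfrak m)$ is the minimum number of elements of $A$ needed to generate $\mathfrak m$ up to radical (and $\infty$ if there is no such finite number). For a finitely generated ideal $\mathfrak c$ with finite generating set $\underline x$ and an $A$-module $M$, the Koszul grade is $\mathrm{K.grade}_A(\mathfrak c,M)=\inf\{i\ge 0: H^i(\mathrm{Hom}_A(K_\bullet(\underline x),M))\ne 0\}$, where $K_\bullet(\underline x)$ is the Koszul complex; for an arbitrary ideal $\mathfrak b$, $\mathrm{K.grade}_A(\mathfrak b,M)$ is the supremum of $\mathrm{K.grade}_A(\mathfrak c,M)$ over all finitely generated subideals $\mathfrak c\subseteq\mathfrak b$. For quasilocal $(A,\mathfrak m)$, $\mathrm{Kdepth}(A)=\mathrm{K.grade}_A(\mathfrak m,A)$. *)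

(* Defs.v *)
From HB Require Import structures.
From mathcomp Require Import all_boot all_order all_algebra.
From mathcomp Require Import generic_quotient ring_quotient.
From mathcomp Require Import boolp classical_sets ereal reals Rstruct.

Set Implicit Arguments.
Unset Strict Implicit.
Unset Printing Implicit Defensive.

Import Order.TTheory GRing.Theory Num.Theory.
Local Open Scope classical_set_scope.
Local Open Scope ring_scope.
Local Open Scope quotient_scope.

(* Homological and Krull dimensions take values in the extended reals, so that
   suprema and infima are always defined: [dim_inf set0] is [+oo]. *)
Notation edim := (\bar Rdefinitions.R).

Definition dim_of_nat (n : nat) : edim := (n%:R)%:E.
Definition dim_inf (S : set nat) : edim := ereal_inf (dim_of_nat @` S).
Definition dim_sup (S : set nat) : edim := ereal_sup (dim_of_nat @` S).

(* The carrier of the tensor product consists of formal sums of pure tensors,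
   written as lists, modulo the congruence below.  The rule [TensZ] with
   [a := -1] provides opposites, so no formal differences are needed. *)
Section TensorProduct.
Variables (A : comNzRingType) (M N : lmodType A).

Inductive tens_rel : seq (M * N) -> seq (M * N) -> Prop :=
| TensRefl s : tens_rel s s
| TensSym s t : tens_rel s t -> tens_rel t s
| TensTrans s t u : tens_rel s t -> tens_rel t u -> tens_rel s u
| TensCat s s' t t' :
    tens_rel s s' -> tens_rel t t' -> tens_rel (s ++ t) (s' ++ t')
| TensC s t : tens_rel (s ++ t) (t ++ s)
| Tens0 n : tens_rel [:: (0, n)] [::]
| TensDl m m' n : tens_rel [:: (m + m', n)] [:: (m, n); (m', n)]
| TensDr m n n' : tens_rel [:: (m, n + n')] [:: (m, n); (m, n')]
| TensZ a m n : tens_rel [:: (a *: m, n)] [:: (m, a *: n)].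

Definition tens_relb (s t : seq (M * N)) : bool := `[< tens_rel s t >].

Lemma tens_relb_equiv : equiv_class_of tens_relb.
Proof.
split=> [s|s t|t s u].
- by apply/asboolP; apply: TensRefl.
- by apply/asboolP/asboolP; apply: TensSym.
- by move=> /asboolP st /asboolP tu; apply/asboolP; apply: TensTrans st tu.
Qed.

Canonical tens_relb_equivRel := EquivRelPack tens_relb_equiv.
Canonical tens_relb_encModRel := defaultEncModRel tens_relb.

Definition tensor := {eq_quot tens_relb}.
HB.instance Definition _ : EqQuotient _ tens_relb tensor :=
  EqQuotient.on tensor.
HB.instance Definition _ := Choice.on tensor.

Definition tens_class (s : seq (M * N)) : tensor := \pi_tensor s.
Definition pure (m : M) (n : N) : tensor := tens_class [:: (m, n)].

Lemma tens_classP s t : tens_class s = tens_class t <-> tens_rel s t.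
Proof.
split=> [/eqP|st]; last by apply/eqP; rewrite /tens_class piE; apply/asboolP.
by rewrite /tens_class piE => /asboolP.
Qed.

Lemma tens_reprK (x : tensor) : tens_class (repr x) = x.
Proof. exact: reprK. Qed.

Definition tens_scale_seq (a : A) (s : seq (M * N)) :=
  [seq (a *: p.1, p.2) | p <- s].

Lemma tens_scale_rel a s t :
  tens_rel s t -> tens_rel (tens_scale_seq a s) (tens_scale_seq a t).
Proof.
elim=> {s t}.
- by move=> s; apply: TensRefl.
- by move=> s t _; apply: TensSym.
- by move=> s t u _ st _; apply: TensTrans.
- by move=> s s' t t' _ ss' _ tt'; rewrite /tens_scale_seq !map_cat;
    apply: TensCat.
- by move=> s t; rewrite /tens_scale_seq !map_cat; apply: TensC.
- by move=> n /=; rewrite scaler0; apply: Tens0.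
- by move=> m m' n /=; rewrite scalerDr; apply: TensDl.
- by move=> m n n'; apply: TensDr.
- by move=> b m n /=; rewrite scalerA mulrC -scalerA; apply: TensZ.
Qed.

Definition tens_zero : tensor := tens_class [::].
Definition tens_add (x y : tensor) : tensor := tens_class (repr x ++ repr y).
Definition tens_scale (a : A) (x : tensor) : tensor :=
  tens_class (tens_scale_seq a (repr x)).
Definition tens_opp (x : tensor) : tensor := tens_scale (-1) x.

Lemma tens_addE s t :
  tens_add (tens_class s) (tens_class t) = tens_class (s ++ t).
Proof. by apply/tens_classP; apply: TensCat; apply/tens_classP/tens_reprK. Qed.

Lemma tens_scaleE a s :
  tens_scale a (tens_class s) = tens_class (tens_scale_seq a s).
Proof. by apply/tens_classP; apply/tens_scale_rel/tens_classP/tens_reprK. Qed.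

Lemma tens_ind (P : tensor -> Prop) : (forall s, P (tens_class s)) -> forall x, P x.
Proof. by move=> Ps x; rewrite -(tens_reprK x). Qed.

Lemma tens_addA : associative tens_add.
Proof.
by elim/tens_ind=> s; elim/tens_ind=> t; elim/tens_ind=> u;
  rewrite !tens_addE catA.
Qed.

Lemma tens_addC : commutative tens_add.
Proof.
by elim/tens_ind=> s; elim/tens_ind=> t; rewrite !tens_addE;
  apply/tens_classP; apply: TensC.
Qed.

Lemma tens_add0 : left_id tens_zero tens_add.
Proof. by elim/tens_ind=> s; rewrite /tens_zero tens_addE. Qed.

Lemma tens_scaleA a b x : tens_scale a (tens_scale b x) = tens_scale (a * b) x.
Proof.
elim/tens_ind: x => s; rewrite !tens_scaleE /tens_scale_seq -map_comp.
by congr tens_class; apply: eq_map => p /=; rewrite scalerA.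
Qed.

Lemma tens_scale1 : left_id 1 tens_scale.
Proof.
elim/tens_ind=> s; rewrite tens_scaleE; congr tens_class.
by rewrite -[RHS]map_id; apply: eq_map => -[m n] /=; rewrite scale1r.
Qed.

Lemma tens_scaleDr : right_distributive tens_scale tens_add.
Proof.
move=> a; elim/tens_ind=> s; elim/tens_ind=> t.
by rewrite tens_addE !tens_scaleE tens_addE /tens_scale_seq map_cat.
Qed.

Lemma tens_scaleDl x a b :
  tens_scale (a + b) x = tens_add (tens_scale a x) (tens_scale b x).
Proof.
elim/tens_ind: x; elim=> [|[m n] s IHs].
  by rewrite !tens_scaleE tens_addE.
have consE c : tens_class (tens_scale_seq c ((m, n) :: s)) =
    tens_add (pure (c *: m) n) (tens_scale c (tens_class s)).
  by rewrite tens_scaleE tens_addE.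
rewrite ![tens_scale _ (tens_class (_ :: _))]tens_scaleE !consE IHs.
have -> : pure ((a + b) *: m) n = tens_add (pure (a *: m) n) (pure (b *: m) n).
  by rewrite tens_addE scalerDl; apply/tens_classP; apply: TensDl.
by rewrite -!tens_addA; congr tens_add; rewrite tens_addA
  [tens_add (pure _ _) _]tens_addC -tens_addA.
Qed.

Lemma tens_scale0 x : tens_scale 0 x = tens_zero.
Proof.
elim/tens_ind: x => s; rewrite tens_scaleE; apply/tens_classP.
elim: s => [|[m n] s IHs] /=; first exact: TensRefl.
rewrite scale0r; exact: (@TensCat [:: (0, n)] [::] _ [::] (Tens0 n) IHs).
Qed.

Lemma tens_addN : left_inverse tens_zero tens_opp tens_add.
Proof.
move=> x; rewrite -[X in tens_add _ X]tens_scale1 -tens_scaleDl addNr.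
exact: tens_scale0.
Qed.

HB.instance Definition _ :=
  GRing.isZmodule.Build tensor tens_addA tens_addC tens_add0 tens_addN.
HB.instance Definition _ :=
  GRing.Zmodule_isLmodule.Build A tensor tens_scaleA tens_scale1
    tens_scaleDr tens_scaleDl.

Lemma pureDl m m' n : pure (m + m') n = pure m n + pure m' n.
Proof. by apply: etrans (esym (tens_addE _ _)); apply/tens_classP/TensDl. Qed.

Lemma pureDr m n n' : pure m (n + n') = pure m n + pure m n'.
Proof. by apply: etrans (esym (tens_addE _ _)); apply/tens_classP/TensDr. Qed.

Lemma pureZl a m n : pure (a *: m) n = a *: pure m n.
Proof. by apply: esym; apply: (tens_scaleE a [:: (m, n)]). Qed.

Lemma pureZr a m n : pure m (a *: n) = a *: pure m n.
Proof. by rewrite -pureZl; apply/tens_classP; apply/TensSym/TensZ. Qed.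

Lemma tens_class_sum s : tens_class s = \sum_(p <- s) pure p.1 p.2.
Proof.
elim: s => [|[m n] s IHs]; first by rewrite big_nil.
by rewrite big_cons -IHs; symmetry; apply: (tens_addE [:: (m, n)] s).
Qed.

Lemma tens_rel_bilinear (B : lmodType A) (b : M -> N -> B) s t :
    (forall n, linear (b^~ n)) -> (forall m, linear (b m)) ->
  tens_rel s t -> \sum_(p <- s) b p.1 p.2 = \sum_(p <- t) b p.1 p.2.
Proof.
move=> bl br.
have bl0 n : b 0 n = 0.
  by have := bl n (-1) 0 0; rewrite /= scaler0 addr0 scaleN1r addNr.
have br0 m : b m 0 = 0.
  by have := br m (-1) 0 0; rewrite /= scaler0 addr0 scaleN1r addNr.
elim=> {s t}.
- by [].
- by move=> s t _ ->.
- by move=> s t u _ -> _ ->.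
- by move=> s s' t t' _ ss' _ tt'; rewrite !big_cat /= ss' tt'.
- by move=> s t; rewrite !big_cat /= addrC.
- by move=> n; rewrite big_seq1 big_nil.
- move=> m m' n; rewrite !big_cons !big_nil /= !addr0.
  by have := bl n 1 m m'; rewrite /= !scale1r.
- move=> m n n'; rewrite !big_cons !big_nil /= !addr0.
  by have := br m 1 n n'; rewrite /= !scale1r.
- move=> a m n; rewrite !big_seq1 /=.
  have := bl n a m 0; have := br m a n 0.
  by rewrite /= bl0 br0 !addr0 => -> ->.
Qed.

End TensorProduct.

Section Flatness.
Variable A : comNzRingType.

(* The map [f (x) id] from [N (x) M] to [P (x) M]. *)
Definition tensor_map (M N P : lmodType A) (f : {linear N -> P})
    (x : tensor N M) : tensor P M :=
  \sum_(p <- repr x) pure (f p.1) p.2.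

Lemma tensor_map_pure (M N P : lmodType A) (f : {linear N -> P}) n m :
  tensor_map f (pure n m : tensor N M) = pure (f n) m.
Proof.
have /tens_classP r := tens_reprK (pure n m : tensor N M).
rewrite /tensor_map.
rewrite (tens_rel_bilinear (b := fun n m => pure (f n) m) _ _ r) ?big_seq1 //.
- by move=> m' a u v /=; rewrite linearP pureDl pureZl.
- by move=> n' a u v /=; rewrite pureDr pureZr.
Qed.

Definition flat (M : lmodType A) : Prop :=
  forall (N P : lmodType A) (f : {linear N -> P}),
    injective f -> injective (@tensor_map M N P f).

(* There is an exact sequence 0 -> F_n -> ... -> F_0 -> M -> 0 with all F_i
   flat, written as an infinite resolution that vanishes beyond degree n. *)
Definition has_flat_resolution (M : lmodType A) (n : nat) : Prop :=
  exists (F : nat -> lmodType A) (d : forall i, {linear F i.+1 -> F i})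
         (e : {linear F 0 -> M}),
  [/\ forall i, flat (F i),
      forall i, (n < i)%N -> forall x : F i, x = 0,
      range e = setT,
      [set x | e x = 0] = range (d 0) &
      forall i, [set x | d i x = 0] = range (d i.+1)].

Definition flat_dim (M : lmodType A) : edim := dim_inf (has_flat_resolution M).

End Flatness.

Definition wdim (A : comNzRingType) : edim :=
  ereal_sup [set d | exists M : lmodType A, d = flat_dim M].

Section Ideals.
Variable A : comNzRingType.

(* [idealr_closed] asserts closure under linear combinations and properness. *)
Definition prime_ideal (p : set A) : Prop :=
  idealr_closed (mem p) /\ prime_idealr_closed (mem p).

Definition maximal_ideal (m : set A) : Prop :=
  idealr_closed (mem m) /\
  forall J : set A, idealr_closed (mem J) -> m `<=` J -> J = m.

Definition quasilocal (m : set A) : Prop :=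
  maximal_ideal m /\ forall m' : set A, maximal_ideal m' -> m' = m.

Definition krull_dim : edim :=
  dim_sup [set n | exists p : nat -> set A,
    (forall i, (i <= n)%N -> prime_ideal (p i)) /\
    (forall i, (i < n)%N -> p i `<` p i.+1)].

Definition ideal_span (n : nat) (x : n.-tuple A) : set A :=
  [set a | exists c : 'I_n -> A, a = \sum_(j < n) c j * tnth x j].

Definition radical (I : set A) : set A := [set a | exists k : nat, I (a ^+ k)].

Definition ara (I : set A) : edim :=
  dim_inf [set n | exists x : n.-tuple A, radical (ideal_span x) = radical I].

(* Exactness of A^q -> A^p -> S -> 0 for a submodule S of M, the second map
   being composed with the inclusion of S in M. *)
Definition finitely_presented_sub (M : lmodType A) (S : set M) : Prop :=
  exists (p q : nat) (g : {linear 'rV[A]_q -> 'rV[A]_p})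
         (e : {linear 'rV[A]_p -> M}),
    range e = S /\ [set v | e v = 0] = range g.

Definition coherent : Prop :=
  forall (n : nat) (x : n.-tuple A),
    finitely_presented_sub (ideal_span x : set A^o).

End Ideals.

Section KoszulGrade.
Variable A : comNzRingType.

(* The i-th exterior power of A^n, in the basis e_S = e_j1 /\ ... /\ e_ji
   indexed by the subsets S = {j1 < ... < ji} of 'I_n. *)
Definition koszul (n i : nat) : lmodType A :=
  {ffun {S : {set 'I_n} | #|S| == i} -> A^o}.

(* The coordinate on e_T of the Koszul differential
   e_j1 /\ ... /\ e_jp |-> \sum_k (-1)^(k-1) x_jk e_j1 /\ .. ^ejk .. /\ e_jp:
   the vector e_T occurs in the image of e_S exactly when S = T U {j}. *)
Definition koszul_diff (n i : nat) (x : n.-tuple A) (f : koszul n i.+1) :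
    koszul n i :=
  [ffun T : {T : {set 'I_n} | #|T| == i} =>
    \sum_(S : {S : {set 'I_n} | #|S| == i.+1})
      \sum_(j < n | (j \notin val T) && (val S == j |: val T))
        (-1) ^+ #|[pred k in val T | (k < j)%N]| * tnth x j * f S].

Definition koszul_cocycle (n i : nat) (x : n.-tuple A) (M : lmodType A)
    (phi : {linear koszul n i -> M}) : Prop :=
  forall z : koszul n i.+1, phi (koszul_diff x z) = 0.

Definition koszul_coboundary (n i : nat) (x : n.-tuple A) (M : lmodType A) :
    {linear koszul n i -> M} -> Prop :=
  match i return {linear koszul n i -> M} -> Prop with
  | 0 => fun phi => forall z, phi z = 0
  | i'.+1 => fun phi =>
      exists psi : {linear koszul n i' -> M},
        forall z, phi z = psi (koszul_diff x z)
  end.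

Definition koszul_cohomology_neq0 (n : nat) (x : n.-tuple A) (M : lmodType A)
    (i : nat) : Prop :=
  exists phi : {linear koszul n i -> M},
    koszul_cocycle x phi /\ ~ koszul_coboundary x phi.

Definition Kgrade_fg (n : nat) (x : n.-tuple A) (M : lmodType A) : edim :=
  dim_inf (koszul_cohomology_neq0 x M).

Definition Kgrade (b : set A) (M : lmodType A) : edim :=
  ereal_sup [set d | exists (n : nat) (x : n.-tuple A),
    ideal_span x `<=` b /\ d = Kgrade_fg x M].

Definition Kdepth (m : set A) : edim := Kgrade m A^o.

End KoszulGrade.

(* Main.v *)
From HB Require Import structures.
Require Import Defs.
From mathcomp Require Import all_boot all_order all_algebra.
From mathcomp Require Import generic_quotient ring_quotient.
From mathcomp Require Import boolp classical_sets ereal reals Rstruct.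

Set Implicit Arguments.
Unset Strict Implicit.
Unset Printing Implicit Defensive.

Import Order.TTheory GRing.Theory Num.Theory.
Local Open Scope classical_set_scope.
Local Open Scope ring_scope.
Local Open Scope quotient_scope.

(** Let [d] be the weak dimension of [A].

    Homological algebra enters through the predicate [tor1_zero M N], the vanishing
    of Tor_1(M, N).  It is symmetric, does not depend on the presentation
    ([tensor_snake], [tor1_zero_inj]), and satisfies dimension shifting
    ([tor1_zero_shift]); hence Tor_1(K, N) = 0 whenever [K] is an [n]-th flat syzygy
    and [N] has flat dimension at most [n] ([tor1_zero_syzygy]).  In particular every
    [d]-th syzygy is flat.

    Kdepth(A) <= d.  Let [x] be a finite family in the maximal ideal [m] with
    H^i(x; A) = 0 for all [i <= d].  The Koszul cochain complex K^0 -> K^1 -> ... then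
    makes the cokernel of K^0 -> K^1 a [d]-th syzygy, so K^0 -> K^1 stays injective
    after tensoring with A/m, where it is zero: a contradiction ([koszul_nonzero_below]).

    d <= Kdepth(A), for [d > 0].  Flatness is tested on finitely presented modules
    ([flat_fin_pres]), so some finitely presented [C] has flat dimension [d].  By
    coherence it has a resolution by finite free modules; its [d]-th syzygy [T] is
    finitely generated and flat, hence free ([fg_flat_free]), while the previous
    syzygy [P] = A^q/T is not flat.  So the inclusion of [T] in A^q does not split,
    and some element [w] of [T] with an invertible coordinate is mapped to a vector
    [t] with coordinates in [m] ([coker_not_flat]).  If [x] generates these
    coordinates up to radical, then H^g(x; A) = 0 for [g < d] ([koszul_vanish]): a
    nonzero class of least degree may be taken to be killed by the coordinates of
    [t]; its product with [w] is a nonzero class with values in [T] that dies in A^q,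
    so it comes from H^(g-1)(x; P), which is zero since [P] is a [(d-1)]-st syzygy.  Taking for [x] the
    coordinates of [t] gives the inequality.

    The other two bounds follow from the same vanishing and from the fact that the
    cohomology of [x] does not vanish in the degree equal to the number of its elements
    ([koszul_top_nonzero]).  If [x] generates [m] up to radical, this forces
    [x] to have at least [d] elements.  If all chains of primes had length less than [d],
    Kronecker's theorem would give [d - 1] elements of [m] generating the coordinates
    of [t] up to radical ([radical_generation]), which is again impossible. *)

(** * Submodules, cokernels and short exact sequences *)

Section Modules.
Variable A : comNzRingType.
Implicit Types U V W K F M : lmodType A.

Definition linear_of U V (f : U -> V) (fl : linear f) : {linear U -> V} :=
  HB.pack f (GRing.isLinear.Build A U V *:%R f fl).

Definition onto U V (f : U -> V) := forall y, exists x, f x = y.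

Section Submodule.
Variables (V : lmodType A) (S : set V) (Scl : submod_closed (mem S)).

Let subm_pred := fun x : V => `[< S x >].
Let subm_closed : submod_closed subm_pred.
Proof.
case: Scl => S0 Sl; split=> [|a u v]; first by have := S0; rewrite !inE.
by have := Sl a u v; rewrite !inE.
Qed.
HB.instance Definition _ := GRing.isSubmodClosed.Build A V subm_pred subm_closed.
Let subm := {x : V | subm_pred x}.
HB.instance Definition _ := SubChoice.on subm.
HB.instance Definition _ := [SubChoice_isSubLmodule of subm by <:].

(** Submodules and cokernels are used only through the universal data given by
    this lemma and by [coker_exists], so that the carrier types stay hidden. *)
Lemma sub_exists : exists (W : lmodType A) (i : {linear W -> V}),
  injective i /\ forall v, S v <-> exists w, i w = v.
Proof.
exists subm, (val : {linear subm -> V}); split; first exact: val_inj.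
move=> v; split=> [Sv|[w <-]]; last by apply/asboolP; exact: (valP w).
have Pv : subm_pred v by apply/asboolP.
by exists (exist _ v Pv).
Qed.
End Submodule.

Section Cokernel.
Variables (U V : lmodType A) (f : {linear U -> V}).

Let cok_rel (x y : V) : bool := `[< exists u, f u = x - y >].
Let cok_equiv : equiv_class_of cok_rel.
Proof.
split=> [x|x y|y x z].
- by apply/asboolP; exists 0; rewrite linear0 subrr.
- by apply/asboolP/asboolP => -[u fu]; exists (- u); rewrite linearN fu opprB.
- move=> /asboolP[u fu] /asboolP[v fv]; apply/asboolP; exists (u + v).
  by rewrite linearD fu fv addrA subrK.
Qed.
Canonical cok_equivRel := EquivRelPack cok_equiv.
Canonical cok_encModRel := defaultEncModRel cok_rel.
Let cok := {eq_quot cok_rel}.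
HB.instance Definition _ : EqQuotient _ cok_rel cok := EqQuotient.on cok.
HB.instance Definition _ := Choice.on cok.

Let cls (v : V) : cok := \pi_cok v.
Let clsP x y : cls x = cls y <-> exists u, f u = x - y.
Proof.
split=> [/eqP|st]; last by apply/eqP; rewrite /cls piE; apply/asboolP.
by rewrite /cls piE => /asboolP.
Qed.
Let clsK x : cls (repr x) = x. Proof. exact: reprK. Qed.
Let cind (P : cok -> Prop) : (forall s, P (cls s)) -> forall x, P x.
Proof. by move=> Ps x; rewrite -(clsK x). Qed.

Let czero : cok := cls 0.
Let cadd (x y : cok) : cok := cls (repr x + repr y).
Let copp (x : cok) : cok := cls (- repr x).
Let cscale (a : A) (x : cok) : cok := cls (a *: repr x).
Let caddE x y : cadd (cls x) (cls y) = cls (x + y).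
Proof.
have /clsP[u fu] := clsK (cls x); have /clsP[v fv] := clsK (cls y).
by apply/clsP; exists (u + v); rewrite linearD fu fv opprD addrACA.
Qed.
Let coppE x : copp (cls x) = cls (- x).
Proof.
have /clsP[u fu] := clsK (cls x).
by apply/clsP; exists (- u); rewrite linearN fu opprD.
Qed.
Let cscaleE a x : cscale a (cls x) = cls (a *: x).
Proof.
have /clsP[u fu] := clsK (cls x).
by apply/clsP; exists (a *: u); rewrite linearZ_LR /= fu scalerBr.
Qed.
Let caddA : associative cadd.
Proof. by do 3!elim/cind=> ?; rewrite !caddE addrA. Qed.
Let caddC : commutative cadd.
Proof. by do 2!elim/cind=> ?; rewrite !caddE addrC. Qed.
Let cadd0 : left_id czero cadd.
Proof. by elim/cind=> ?; rewrite caddE add0r. Qed.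
Let caddN : left_inverse czero copp cadd.
Proof. by elim/cind=> ?; rewrite coppE caddE addNr. Qed.
HB.instance Definition _ := GRing.isZmodule.Build cok caddA caddC cadd0 caddN.
Let cscaleA a b x : cscale a (cscale b x) = cscale (a * b) x.
Proof. by elim/cind: x => ?; rewrite !cscaleE scalerA. Qed.
Let cscale1 : left_id 1 cscale.
Proof. by elim/cind=> ?; rewrite cscaleE scale1r. Qed.
Let cscaleDr : right_distributive cscale +%R.
Proof.
move=> a; elim/cind=> x; elim/cind=> y.
by rewrite [LHS](_ : _ = cscale a (cadd (cls x) (cls y))) // caddE !cscaleE
   scalerDr -caddE.
Qed.
Let cscaleDl x : {morph cscale^~ x : a b / a + b}.
Proof. by move=> a b; elim/cind: x => x; rewrite !cscaleE scalerDl -caddE. Qed.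
HB.instance Definition _ := GRing.Zmodule_isLmodule.Build A cok
  cscaleA cscale1 cscaleDr cscaleDl.

Let cls_linear : linear cls.
Proof. by move=> a x y; rewrite -caddE -cscaleE. Qed.

Lemma coker_exists : exists (C : lmodType A) (p : {linear V -> C}),
  onto p /\ forall v, p v = 0 <-> exists u, f u = v.
Proof.
exists cok, (linear_of cls_linear); split=> [y|v]; first by exists (repr y); exact: clsK.
rewrite (_ : (0 : cok) = cls 0) //.
by have := clsP v 0; rewrite subr0.
Qed.
End Cokernel.

Lemma lin_eq0_inj U V (f : {linear U -> V}) :
  (forall x, f x = 0 -> x = 0) -> injective f.
Proof.
by move=> f0 x y fxy; apply/subr0_eq/f0; rewrite linearB fxy subrr.
Qed.

(** The universal property of a cokernel. *)
Lemma factor_onto U V W (p : {linear U -> V}) (f : {linear U -> W}) :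
  onto p -> (forall x, p x = 0 -> f x = 0) ->
  exists g : {linear V -> W}, forall x, g (p x) = f x.
Proof.
move=> ponto pf; have [s sK] := choice ponto.
have gE x y : p x = p y -> f x = f y.
  by move=> xy; apply/subr0_eq; rewrite -linearB pf // linearB xy subrr.
have gl : linear (f \o s).
  by move=> a x y /=; rewrite -linearP; apply: gE; rewrite linearP !sK.
by exists (linear_of gl) => x /=; apply: gE; rewrite sK.
Qed.

(** The universal property of a kernel. *)
Lemma factor_inj U V W (i : {linear U -> V}) (f : {linear W -> V}) :
  injective i -> (forall x, exists u, i u = f x) ->
  exists g : {linear W -> U}, forall x, i (g x) = f x.
Proof.
move=> iinj fi; have [s sK] := choice fi.
have gl : linear s by move=> a x y; apply: iinj; rewrite linearP !sK linearP.
by exists (linear_of gl).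
Qed.

Definition short_exact K F M (i : {linear K -> F}) (p : {linear F -> M}) : Prop :=
  [/\ injective i, onto p &
      forall x, p x = 0 <-> exists k, i k = x].

Lemma short_exact_ker F M (p : {linear F -> M}) : onto p ->
  exists (K : lmodType A) (i : {linear K -> F}), short_exact i p.
Proof.
move=> ponto; have [|K [i [iinj iP]]] := @sub_exists F [set x | p x = 0].
  split=> [|a u v]; rewrite !inE /=; first by rewrite linear0.
  by move=> u0 v0; rewrite linearP u0 v0 scaler0 addr0.
by exists K, i; split.
Qed.

Lemma short_exact_coker K F (i : {linear K -> F}) : injective i ->
  exists (M : lmodType A) (p : {linear F -> M}), short_exact i p.
Proof. by move=> iinj; have [M [p [po pP]]] := coker_exists i; exists M, p. Qed.

End Modules.

(** * Exactness of the tensor product *)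

Section Tensor.
Variable A : comNzRingType.
Implicit Types K L M N P F G : lmodType A.

Definition bilinear_map M N P (b : M -> N -> P) :=
  (forall n, linear (b^~ n)) /\ (forall m, linear (b m)).

Lemma bilin_pure M N : bilinear_map (fun m n => pure m n : tensor M N).
Proof.
by split=> [n a u v|m a u v]; rewrite ?pureDl ?pureZl ?pureDr ?pureZr.
Qed.

Lemma pure0l M N (n : N) : pure (0 : M) n = 0.
Proof. exact: (linear0 (linear_of ((bilin_pure M N).1 n))). Qed.
Lemma pure0r M N (m : M) : pure m (0 : N) = 0.
Proof. exact: (linear0 (linear_of ((bilin_pure M N).2 m))). Qed.
Lemma pureBl M N (x y : M) (n : N) : pure (x - y) n = pure x n - pure y n.
Proof. exact: (linearB (linear_of ((bilin_pure M N).1 n))). Qed.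
Lemma pure_sumr M N (m : M) (I : finType) (f : I -> N) :
  pure m (\sum_i f i) = \sum_i pure m (f i).
Proof. exact: (linear_sum (linear_of ((bilin_pure M N).2 m))). Qed.

(** Pure tensors generate: the induction principle behind every computation
    with tensor products below. *)
Lemma tensor_generated M N (P : tensor M N -> Prop) :
  (forall m n, P (pure m n)) -> (forall x y, P x -> P y -> P (x + y)) ->
  P 0 -> forall x, P x.
Proof.
move=> Ppure PD P0 x; rewrite -(tens_reprK x) tens_class_sum.
by elim/big_ind: _.
Qed.

Definition tlift_fun M N P (b : M -> N -> P) (x : tensor M N) : P :=
  \sum_(p <- repr x) b p.1 p.2.

Lemma tlift_class M N P (b : M -> N -> P) s : bilinear_map b ->
  tlift_fun b (tens_class s) = \sum_(p <- s) b p.1 p.2.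
Proof.
by case=> bl br; apply: (tens_rel_bilinear bl br); apply/tens_classP/tens_reprK.
Qed.

Lemma tlift_linear M N P (b : M -> N -> P) : bilinear_map b -> linear (tlift_fun b).
Proof.
move=> bb a; elim/tens_ind=> s; elim/tens_ind=> t.
have -> : a *: (tens_class s : tensor M N) + tens_class t =
   tens_class (tens_scale_seq a s ++ t).
  by rewrite -tens_addE -tens_scaleE.
rewrite !tlift_class // big_cat /= big_map scaler_sumr; congr (_ + _).
apply: eq_bigr => p _ /=; case: bb => /(_ p.2) bl _.
exact: (linearZ_LR (linear_of bl)).
Qed.

Lemma tlift_subproof M N P (b : M -> N -> P) : bilinear_map b ->
  {f : {linear tensor M N -> P} | forall m n, f (pure m n) = b m n}.
Proof.
move=> bb; exists (linear_of (tlift_linear bb)) => m n.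
by rewrite /pure [LHS]tlift_class // big_seq1.
Qed.

Definition tlift M N P (b : M -> N -> P) (bb : bilinear_map b) :
  {linear tensor M N -> P} := sval (tlift_subproof bb).

Lemma tlift_pure M N P (b : M -> N -> P) (bb : bilinear_map b) m n :
  tlift bb (pure m n) = b m n.
Proof. exact: (svalP (tlift_subproof bb)). Qed.

Lemma tensor_linear_ext M N P (f g : {linear tensor M N -> P}) :
  (forall m n, f (pure m n) = g (pure m n)) -> f =1 g.
Proof.
move=> fg; apply: tensor_generated => // [x y|]; first by rewrite !linearD => -> ->.
by rewrite !linear0.
Qed.

Lemma tmapl_bilin N P (f : {linear N -> P}) M :
  bilinear_map (fun n (m : M) => pure (f n) m).
Proof.
split=> [m|n]; last exact: (bilin_pure P M).2.
by move=> a u v /=; rewrite linearP (bilin_pure P M).1.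
Qed.
Definition tmapl N P (f : {linear N -> P}) M :
  {linear tensor N M -> tensor P M} := tlift (tmapl_bilin f M).

Lemma tmap_bilin M N P (f : {linear N -> P}) :
  bilinear_map (fun (m : M) n => pure m (f n)).
Proof.
split=> [n|m]; first exact: (bilin_pure M P).1.
by move=> a u v /=; rewrite linearP (bilin_pure M P).2.
Qed.
Definition tmapr M N P (f : {linear N -> P}) :
  {linear tensor M N -> tensor M P} := tlift (tmap_bilin M f).

Lemma tmaplE N P (f : {linear N -> P}) M n m : tmapl f M (pure n m) = pure (f n) m.
Proof. exact: tlift_pure. Qed.
Lemma tmaprE M N P (f : {linear N -> P}) m n : tmapr M f (pure m n) = pure m (f n).
Proof. exact: tlift_pure. Qed.

Lemma tensor_mapE N P (f : {linear N -> P}) M : @tensor_map A M N P f =1 tmapl f M.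
Proof.
have bb := tmapl_bilin f M.
apply: (tensor_linear_ext (f := linear_of (tlift_linear bb))) => n m.
by rewrite tmaplE -(tensor_map_pure f).
Qed.

Lemma flatE M : flat M <-> forall N P (f : {linear N -> P}),
  injective f -> injective (tmapl f M).
Proof.
by split=> fM N P f /fM fi; [apply: eq_inj fi _|apply: eq_inj fi _] => x;
  rewrite tensor_mapE.
Qed.

Lemma tswap_bilin M N : bilinear_map (fun (m : M) (n : N) => pure n m).
Proof. by split=> ?; [apply: (bilin_pure N M).2|apply: (bilin_pure N M).1]. Qed.
Definition tswap M N : {linear tensor M N -> tensor N M} :=
  tlift (tswap_bilin M N).
Lemma tswapE M N m n : tswap M N (pure m n) = pure n m.
Proof. exact: tlift_pure. Qed.

Lemma tswapK M N : cancel (tswap M N) (tswap N M).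
Proof.
move=> x; apply: (tensor_linear_ext (f := tswap N M \o tswap M N) (g := idfun)) => m n /=.
by rewrite !tswapE.
Qed.

Lemma tmapr_swap M N P (f : {linear N -> P}) x :
  tmapr M f x = tswap P M (tmapl f M (tswap M N x)).
Proof.
apply: (tensor_linear_ext (g := tswap P M \o (tmapl f M \o tswap M N))) => m n /=.
by rewrite tmaprE tswapE tmaplE tswapE.
Qed.

Lemma tmaplr N P M L (f : {linear N -> P}) (g : {linear M -> L}) x :
  tmapl f L (tmapr N g x) = tmapr P g (tmapl f M x).
Proof.
apply: (tensor_linear_ext (f := tmapl f L \o tmapr N g) (g := tmapr P g \o tmapl f M)).
by move=> n m /=; rewrite !(tmaplE, tmaprE).
Qed.

Lemma tmapr_inj_swap M N P (f : {linear N -> P}) :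
  injective (tmapr M f) <-> injective (tmapl f M).
Proof.
split=> fi x y.
  move=> xy; apply: (can_inj (tswapK (M:=N) (N:=M))); apply: fi.
  by rewrite !tmapr_swap !tswapK xy.
rewrite !tmapr_swap => /(can_inj (tswapK (M:=P) (N:=M)))/fi.
exact: (can_inj (tswapK (M:=M) (N:=N))).
Qed.

Lemma flat_tmapr F N P (f : {linear N -> P}) :
  flat F -> injective f -> injective (tmapr F f).
Proof. by move=> /flatE fF fi; apply/tmapr_inj_swap/fF. Qed.

Lemma tmapl_onto N P (f : {linear N -> P}) M :
  onto f -> onto (tmapl f M).
Proof.
move=> fo; apply: tensor_generated => [p m|x y [u <-] [v <-]|].
- by have [n <-] := fo p; exists (pure n m); rewrite tmaplE.
- by exists (u + v); rewrite linearD.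
- by exists 0; rewrite linear0.
Qed.

Lemma tmapl_comp0 K F M (i : {linear K -> F}) (p : {linear F -> M}) N x :
  (forall k, p (i k) = 0) -> tmapl p N (tmapl i N x) = 0.
Proof.
move=> pi; elim/tensor_generated: x => [k n|x y x0 y0|].
- by rewrite !tmaplE pi pure0l.
- by rewrite !linearD /= x0 y0 addr0.
- by rewrite !linear0.
Qed.

(** Right exactness of the tensor product.  The inverse of the induced map from
    the cokernel of [tmapl i N] to [M (x) N] is the bilinear map sending [(p y, n)]
    to the class of [y (x) n]; a chosen section [s] of [p] defines it on all of [M]. *)
Lemma tmapl_exact K F M (i : {linear K -> F}) (p : {linear F -> M}) N x :
  onto p -> (forall y, p y = 0 -> exists k, i k = y) ->
  tmapl p N x = 0 -> exists z, tmapl i N z = x.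
Proof.
move=> po pe px; have [C [q [_ qP]]] := coker_exists (tmapl i N).
have [s sK] := choice po.
pose b (m : M) (n : N) := q (pure (s m) n).
have bE y n : b (p y) n = q (pure y n).
  have [k ik] : exists k, i k = s (p y) - y.
    by apply: pe; rewrite linearB sK subrr.
  apply/subr0_eq; rewrite -linearB; apply/qP; exists (pure k n).
  by rewrite tmaplE ik pureBl.
have bb : bilinear_map b.
  split=> [n a u v|m a u v].
    rewrite -[u]sK -[v]sK -linearP !bE (bilin_pure F N).1.
    by rewrite linearP.
  by rewrite /b (bilin_pure F N).2 linearP.
suff: q x = 0 by move/qP.
have <- : tlift bb (tmapl p N x) = q x.
  apply: (tensor_linear_ext (f := tlift bb \o tmapl p N)) => y n.
  by rewrite /= tmaplE tlift_pure bE.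
by rewrite px linear0.
Qed.

Lemma tmapr_exact K F M (i : {linear K -> F}) (p : {linear F -> M}) N x :
  onto p -> (forall y, p y = 0 -> exists k, i k = y) ->
  tmapr N p x = 0 -> exists z, tmapr N i z = x.
Proof.
move=> po pe; rewrite tmapr_swap => /(congr1 (tswap _ _)).
rewrite tswapK linear0 => /(tmapl_exact po pe)[z zE].
by exists (tswap _ _ z); rewrite tmapr_swap tswapK zE tswapK.
Qed.

(** The connecting argument of the snake lemma for the 3x3 diagram of tensor
    products of the two sequences.  An element of [M (x) L] that dies in [M (x) P]
    lifts to [F (x) L]; its image in [F (x) P] comes from [K (x) P], and that
    preimage dies in [K (x) N], hence comes from [K (x) L].  With [F] and [P] flat the two
    injectivity statements say Tor_1(M, N) = 0, computed from either side. *)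
Lemma tensor_snake K F M (i : {linear K -> F}) (p : {linear F -> M})
    L P N (j : {linear L -> P}) (q : {linear P -> N}) :
  short_exact i p -> short_exact j q -> injective (tmapr F j) -> injective (tmapl i N) ->
  injective (tmapr M j).
Proof.
move=> [_ po pP] [_ qo qP] Fj iN; apply: lin_eq0_inj => u u0.
have [v vu] := tmapl_onto (M := L) po u.
have /tmapl_exact : tmapl p P (tmapr F j v) = 0 by rewrite tmaplr vu.
case/(_ K i po (fun y => iffLR (pP y))) => w wE.
have /tmapr_exact : tmapr K q w = 0.
  apply: iN; rewrite linear0 tmaplr wE.
  rewrite tmapr_swap tmapr_swap tswapK tmapl_comp0 ?linear0 // => l.
  by apply/qP; exists l.
case/(_ L j qo (fun y => iffLR (qP y))) => z zE.
have vE : v = tmapl i L z by apply: Fj; rewrite -wE -zE tmaplr.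
by rewrite -vu vE tmapl_comp0 // => k; apply/pP; exists k.
Qed.

End Tensor.

(** * Vanishing of Tor and dimension shifting *)

Section Tor.
Variable A : comNzRingType.
Implicit Types K L M N P F G : lmodType A.

(** Tor_1(M, N) = 0, expressed on one flat presentation of [M]; the lemma
    [tor1_zero_inj] shows that the choice of the presentation is immaterial. *)
Definition tor1_zero M N : Prop :=
  exists (K F : lmodType A) (i : {linear K -> F}) (p : {linear F -> M}),
  [/\ short_exact i p, flat F & injective (tmapl i N)].

Definition has_flat_covers : Prop := forall M,
  exists (F : lmodType A) (p : {linear F -> M}), flat F /\ onto p.

Fixpoint flat_dim_le (n : nat) M : Prop :=
  match n with
  | 0 => flat M
  | n'.+1 => exists (K F : lmodType A) (i : {linear K -> F}) (p : {linear F -> M}),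
      [/\ short_exact i p, flat F & flat_dim_le n' K]
  end.

(** [K] is an [n]-th syzygy of [M]: the recursion peels the exact sequence off at
    the syzygy end, which is the end where [tor1_zero_unshift] and the Koszul
    connecting map are applied. *)
Fixpoint syzygy (C : lmodType A -> Prop) (n : nat) M K : Prop :=
  match n with
  | 0 => K = M
  | n'.+1 => exists (K' F : lmodType A) (i : {linear K -> F}) (p : {linear F -> K'}),
      [/\ short_exact i p, C F & syzygy C n' M K']
  end.

Lemma tor1_zero_inj M N L P (j : {linear L -> P}) (q : {linear P -> N}) :
  tor1_zero M N -> short_exact j q -> injective (tmapr M j).
Proof.
move=> [K [F [i [p [sip Ff iN]]]]] sjq; apply: (tensor_snake sip sjq _ iN).
by case: sjq => ji _ _; apply: flat_tmapr.
Qed.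

Hypothesis cov : has_flat_covers.

Lemma flat_ses M : exists (K F : lmodType A) (i : {linear K -> F}) (p : {linear F -> M}),
  short_exact i p /\ flat F.
Proof.
have [F [p [Ff po]]] := cov M; have [K [i sip]] := short_exact_ker po.
by exists K, F, i, p.
Qed.

Lemma tor1_zero_sym M N : tor1_zero M N -> tor1_zero N M.
Proof.
move=> t; have [K [F [i [p [sip Ff]]]]] := flat_ses N.
exists K, F, i, p; split=> //; apply/tmapr_inj_swap; exact: tor1_zero_inj t sip.
Qed.

Lemma tor1_zero_flat M N : flat N -> tor1_zero M N.
Proof.
move=> Nf; have [K [F [i [p [sip Ff]]]]] := flat_ses M.
exists K, F, i, p; split=> //; move/flatE: Nf; apply; by case: sip.
Qed.

Lemma flat_tor1_zero N : (forall M, tor1_zero M N) -> flat N.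
Proof.
move=> t; apply/flatE => L P f fi; have [M [p sfp]] := short_exact_coker fi.
by apply/tmapr_inj_swap; apply: tor1_zero_inj sfp; apply/tor1_zero_sym.
Qed.

(** Both sides assert that Tor_2(M, N) = 0: by flatness of [F] and [G], each of the maps from
    [K (x) L] to [K (x) G] and to [F (x) L] is injective if and only if the map
    to [F (x) G] is. *)
Lemma tor1_zero_shift K F M (i : {linear K -> F}) (p : {linear F -> M})
    L G N (j : {linear L -> G}) (q : {linear G -> N}) :
  short_exact i p -> short_exact j q -> flat F -> flat G -> tor1_zero K N -> tor1_zero M L.
Proof.
move=> sip sjq Ff Gf t; exists K, F, i, p; split=> //.
have Kj := tor1_zero_inj t sjq.
have iG : injective (tmapl i G) by move/flatE: Gf; apply; case: sip.
move=> x y /(congr1 (tmapr F j)); rewrite -!tmaplr => /iG; exact: Kj.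
Qed.

Lemma tor1_zero_unshift K F M (i : {linear K -> F}) (p : {linear F -> M})
    L G N (j : {linear L -> G}) (q : {linear G -> N}) :
  short_exact i p -> short_exact j q -> flat F -> flat G -> tor1_zero M L -> tor1_zero K N.
Proof.
move=> sip sjq Ff Gf /tor1_zero_sym t; apply: tor1_zero_sym.
exact: (tor1_zero_shift sjq sip Gf Ff t).
Qed.

(** Dimension shifting: Tor_1 of an [n]-th syzygy of [M] against [N] is
    Tor_1 of [M] against an [n]-th syzygy of [N], and the latter can be taken flat. *)
Lemma tor1_zero_syzygy (C : lmodType A -> Prop) n M N K :
  (forall F, C F -> flat F) -> flat_dim_le n N -> syzygy C n M K -> tor1_zero K N.
Proof.
move=> Cf; elim: n N K => [|n IHn] N K /=; first by move=> Nf _; apply: tor1_zero_flat.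
move=> [L [G [j [q [sjq Gf Lfd]]]]] [K' [F [i [p [sip /Cf Ff sK']]]]].
by apply: (tor1_zero_unshift sip sjq) => //; apply: IHn.
Qed.

Lemma syzygy_flat_dim_le n M K : syzygy (@flat A) n M K -> flat K -> flat_dim_le n M.
Proof.
rewrite -[n in flat_dim_le n _]add0n -[flat K]/(flat_dim_le 0 K).
(* [m] counts the syzygies already absorbed into the resolution of [K]. *)
elim: n 0%N K => [|n IHn] m K /=; first by rewrite addn0 => ->.
move=> [K' [F [i [p [sip Ff sK']]]]] Kf; rewrite addnS -addSn.
by apply: IHn sK' _; exists K, F, i, p.
Qed.

Lemma flat_syzygy_exists n M : exists K, syzygy (@flat A) n M K.
Proof.
elim: n => [|n [K sK]]; first by exists M.
by have [K' [F [i [p [sip Ff]]]]] := flat_ses K; exists K', K, F, i, p.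
Qed.

End Tor.

(** * Flat resolutions *)

Section Resolutions.
Variable A : comNzRingType.
Implicit Types K L M N P F G : lmodType A.

Lemma flat_iso M N (f : {linear M -> N}) : injective f -> onto f -> flat M -> flat N.
Proof.
move=> fi fo /flatE Mf; apply/flatE => L P j ji.
have [g gK] := factor_onto (p := f) (f := idfun) fo
  (fun x e => fi _ _ (etrans e (esym (linear0 f)))).
apply: lin_eq0_inj => x x0.
have -> : x = tmapr L f (tmapr L g x).
  apply: (tensor_linear_ext (f := idfun) (g := tmapr L f \o tmapr L g)) => l n /=.
  by rewrite !tmaprE; have [m <-] := fo n; rewrite gK.
rewrite [tmapr L g x](_ : _ = 0) ?linear0 //.
by apply: (Mf _ _ j ji); rewrite tmaplr x0 !linear0.
Qed.

Lemma flat_trivial M : (forall x : M, x = 0) -> flat M.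
Proof.
move=> M0; apply/flatE => N P f fi.
apply: lin_eq0_inj => x _; elim/tensor_generated: x => [k m|x y -> ->|//].
  by rewrite (M0 m) pure0r.
by rewrite addr0.
Qed.

Lemma resolution_flat_dim_le n M : has_flat_resolution M n -> flat_dim_le n M.
Proof.
elim: n M => [|n IHn] M [F [d [e [Ff F0 eo ker0 ex]]]].
  apply: (@flat_iso (F 0%N) M e); last exact: Ff.
    apply: lin_eq0_inj => x x0; have : range (d 0%N) x by rewrite -ker0.
    by case=> y _ <-; rewrite (F0 1%N isT y) linear0.
  by move=> y; have : range e y by [rewrite eo]; case=> x _ <-; exists x.
have eon : onto e.
  by move=> y; have : range e y by [rewrite eo]; case=> x _ <-; exists x.
have [K [i sip]] := short_exact_ker eon; exists K, (F 0%N), i, e; split=> //.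
case: sip => ii _ iP.
have keP x : e x = 0 <-> exists y, d 0%N y = x.
  have : [set x | e x = 0] x <-> range (d 0%N) x by rewrite ker0.
  by case=> k1 k2; split=> [/k1[y _ <-]|[y yx]]; [exists y|apply: k2; exists y].
have [|g gE] := @factor_inj A _ _ _ i (d 0%N) ii.
  by move=> x; apply/iP/keP; exists x.
apply: IHn; exists (fun k => F k.+1), (fun k => d k.+1), g; split=> //.
- by move=> k nk x; apply: (F0 k.+1).
- apply/seteqP; split=> // k _; have /keP[y yx] : e (i k) = 0 by apply/iP; exists k.
  by exists y => //; apply: ii; rewrite gE.
- rewrite -ex; apply/seteqP; split=> x /=; first by rewrite -gE => ->; rewrite linear0.
  by move=> x0; apply: ii; rewrite gE x0 linear0.
Qed.

Lemma zero_linear M N : linear (fun _ : M => 0 : N).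
Proof. by move=> a x y; rewrite scaler0 addr0. Qed.
Definition zero_lin M N : {linear M -> N} := linear_of (@zero_linear M N).

(** A module of flat dimension at most [n], presented by nested short exact
    sequences, is spliced into a single resolution. *)
Lemma flat_dim_le_resolution n M : flat_dim_le n M -> has_flat_resolution M n.
Proof.
elim: n M => [|n IHn] M /=.
  move=> Mf; pose Z : lmodType A := 'rV[A]_0.
  have Z0 (x : Z) : x = 0 by apply/rowP=> -[].
  pose F k : lmodType A := if k is 0 then M else Z.
  exists F, (fun k => zero_lin (F k.+1) (F k)), (idfun : {linear M -> M}).
  split=> //.
  - by case=> [|k]; [exact: Mf|exact: flat_trivial].
  - by case=> // k _; exact: Z0.
  - by apply/seteqP; split=> // x _; exists x.
  - by apply/seteqP; split=> x /= => [->|[y _ <-]] //; exists 0.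
  - move=> k; apply/seteqP; split=> x /= => [_|//].
    by exists 0 => //; rewrite [LHS]linear0 [RHS]Z0.
move=> [K [F0 [i [p [[ii po pP] F0f /IHn]]]]] [F [d [e [Ff Fz eo ker0 ex]]]].
pose G k : lmodType A := if k is k'.+1 then F k' else F0.
pose d0 : {linear F 0%N -> F0} := i \o e.
pose dG k : {linear G k.+1 -> G k} :=
  match k return {linear G k.+1 -> G k} with 0 => d0 | k'.+1 => d k' end.
exists G, dG, p; split.
- by case.
- by case=> // k nk; apply: Fz.
- by apply/seteqP; split=> // y _; have [x xy] := po y; exists x.
- apply/seteqP; split=> x /=.
    move=> /pP[k <-]; have [y _ <-] : range e k by rewrite eo.
    by exists y.
  by move=> [y _ <-]; apply/pP; exists (e y).
- case=> [|k] /=; last exact: ex.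
  rewrite -ker0; apply/seteqP; split=> x /=; last by move=> ->; rewrite linear0.
  by move=> x0; apply: ii; rewrite x0 linear0.
Qed.

Lemma flat_dim_leS n M : flat_dim_le n M -> flat_dim_le n.+1 M.
Proof.
move/flat_dim_le_resolution=> [F [d [e [Ff F0 eo ker0 ex]]]].
apply: resolution_flat_dim_le; exists F, d, e; split=> // i ni; apply: F0.
exact: ltn_trans ni.
Qed.

Lemma flat_dim_leW m n M : (m <= n)%N -> flat_dim_le m M -> flat_dim_le n M.
Proof. by move=> /subnK <- Mm; elim: (n - m)%N => // k; apply: flat_dim_leS. Qed.

Lemma flat_dim_le_covers n : (forall M, flat_dim_le n M) -> has_flat_covers A.
Proof.
move=> all M; have [K [F [i [p [[ _ po _] Ff _]]]]] := flat_dim_leS (all M).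
by exists F, p.
Qed.

End Resolutions.

(** * Finite free modules and the finitely presented test for flatness *)

Section FiniteFree.
Variable A : comNzRingType.
Implicit Types U V W K L M N P F G C T : lmodType A.

(** A dual basis in the sense of projective modules; it serves both for the free
    modules of the Koszul complex and for direct summands of row spaces. *)
Definition dual_basis F (I : finType) (e : I -> F) (l : I -> {linear F -> A^o}) :=
  forall x, x = \sum_i (l i x : A) *: e i.

(** Each coordinate functional induces a map [N (x) F -> N] commuting with the
    maps to be tested, and the coordinates of a tensor determine it. *)
Lemma dual_basis_flat F (I : finType) (e : I -> F) (l : I -> {linear F -> A^o}) :
  dual_basis e l -> flat F.
Proof.
move=> el; apply/flatE => N P f fi.
have cb M i : bilinear_map (fun (n : M) x => (l i x : A) *: n).
  split=> [x a u v|n a u v] /=; first by rewrite scalerDr !scalerA mulrC.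
  by rewrite linearP scalerDl -scalerA.
apply: lin_eq0_inj => u fu.
have c0 i : tlift (cb N i) u = 0.
  apply: fi; rewrite linear0 -[RHS](linear0 (tlift (cb P i))) -fu.
  apply: (tensor_linear_ext (f := f \o tlift (cb N i)) (g := tlift (cb P i) \o tmapl f F)).
  by move=> n x /=; rewrite tmaplE !tlift_pure linearZ.
have -> : u = \sum_i pure (tlift (cb N i) u) (e i).
  elim/tensor_generated: (u) => [n x|x y xE yE|].
  - rewrite [x in LHS]el pure_sumr.
    by apply: eq_bigr => i _; rewrite tlift_pure pureZl pureZr.
  - rewrite [in LHS]xE [in LHS]yE -big_split /=; apply: eq_bigr => i _.
    by rewrite linearD pureDl.
  - by rewrite big1 // => i _; rewrite linear0 pure0l.
by rewrite big1 // => i _; rewrite c0 pure0l.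
Qed.

Lemma dual_basis_lift F (I : finType) (e : I -> F) (l : I -> {linear F -> A^o})
    U V (p : {linear U -> V}) (f : {linear F -> V}) :
  dual_basis e l -> (forall x, exists u, p u = f x) ->
  exists g : {linear F -> U}, forall x, p (g x) = f x.
Proof.
move=> el pf; have [s sK] := choice pf.
have gl : linear (fun x => \sum_i (l i x : A) *: s (e i)).
  move=> a x y /=; rewrite scaler_sumr -big_split; apply: eq_bigr => i _ /=.
  by rewrite linearP scalerDl scalerA.
exists (linear_of gl) => x; rewrite /= linear_sum [in RHS](el x) linear_sum.
by apply: eq_bigr => i _; rewrite !linearZ /= sK.
Qed.

Lemma row_coord_linear n (j : 'I_n) : linear (fun v : 'rV[A]_n => v 0 j : A^o).
Proof. by move=> a x y; rewrite !mxE. Qed.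
Definition row_coord n (j : 'I_n) : {linear 'rV[A]_n -> A^o} := linear_of (row_coord_linear j).

Lemma rV_basis n : dual_basis (fun j : 'I_n => delta_mx 0 j) (@row_coord n).
Proof. by move=> v; rewrite [LHS]row_sum_delta. Qed.

Lemma rV_flat n : flat 'rV[A]_n.
Proof. exact (dual_basis_flat (@rV_basis n)). Qed.

Lemma fg_span M (E : seq M) :
  exists q (pi : {linear 'rV[A]_q -> M}), (forall x, x \in E -> exists v, pi v = x) /\
  forall Q : M -> Prop, Q 0 -> (forall a x y, Q x -> Q y -> Q (a *: x + y)) ->
    (forall x, x \in E -> Q x) -> forall v, Q (pi v).
Proof.
exists (size E).
have pl : linear (fun v : 'rV[A]_(size E) => \sum_(j < size E) v 0 j *: E`_j).
  move=> a x y /=; rewrite scaler_sumr -big_split; apply: eq_bigr => i _ /=.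
  by rewrite !mxE scalerDl scalerA.
exists (linear_of pl); split=> [x xE|Q Q0 Ql QE v] /=.
  have xi : (index x E < size E)%N by rewrite index_mem.
  exists (delta_mx 0 (Ordinal xi)); rewrite (bigD1 (Ordinal xi)) //= mxE !eqxx scale1r.
  by rewrite nth_index // big1 ?addr0 // => i ni; rewrite mxE (negPf ni) andbF scale0r.
elim/big_ind: _ => // [x y Qx Qy|i _].
  by rewrite -[x]scale1r; apply: Ql.
by rewrite -[_ *: _]addr0; apply: Ql => //; apply: QE; rewrite mem_nth.
Qed.

Lemma map_cat_inv (S T : Type) (f : S -> T) u s t : map f u = s ++ t ->
  exists u1 u2, [/\ u = u1 ++ u2, map f u1 = s & map f u2 = t].
Proof.
move=> ust; exists (take (size s) u), (drop (size s) u).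
by rewrite cat_take_drop map_take map_drop ust take_size_cat // drop_size_cat.
Qed.

Definition on_fst (U V K : Type) (f : U -> V) (p : U * K) := (f p.1, p.2).

Lemma lift_fst (U V : eqType) (K : Type) (f : U -> V) (s : seq (V * K)) :
  (forall x, x \in [seq p.1 | p <- s] -> exists u, f u = x) ->
  exists s', map (@on_fst U V K f) s' = s.
Proof.
elim: s => [|[x k] s IHs] xs; first by exists [::].
have [|s' <-] := IHs; first by move=> y ys; apply: xs; rewrite inE ys orbT.
have [|u <-] := xs x; first by rewrite inE eqxx.
by exists ((u, k) :: s').
Qed.

(** A derivation of the congruence uses finitely many elements of [M]: it takes
    place inside any submodule containing them. *)
Lemma tens_rel_finitary M K (s t : seq (M * K)) : tens_rel s t ->
  exists E : seq M, forall M' (j : {linear M' -> M}), injective j ->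
    (forall x, x \in E -> exists y, j y = x) ->
    forall s' t', map (@on_fst M' M K j) s' = s -> map (@on_fst M' M K j) t' = t ->
    tens_rel s' t'.
Proof.
have ji M' (j : {linear M' -> M}) : injective j -> injective (map (@on_fst M' M K j)).
  by move=> ji; apply: inj_map => -[x k] [y l] [/ji -> ->].
elim=> {s t}.
- move=> s; exists [::] => M' j /ji jm _ s' t' <- /jm ->; exact: TensRefl.
- by move=> s t _ [E EP]; exists E => M' j jin jE s' t' ss tt; apply: TensSym; exact: (EP M' j jin jE _ _ tt ss).
- move=> s t u _ [E EP] _ [E' EP'].
  exists (E ++ E' ++ [seq p.1 | p <- t]) => M' j jin jE s' u' ss uu.
  have [|t' tt] := @lift_fst M' M K j t.
    by move=> x xt; apply: jE; rewrite !mem_cat xt !orbT.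
  apply: (TensTrans (t := t')).
    by apply: (EP M' j) => // x xE; apply: jE; rewrite mem_cat xE.
  by apply: (EP' M' j) => // x xE; apply: jE; rewrite !mem_cat xE orbT.
- move=> s s' t t' _ [E EP] _ [E' EP']; exists (E ++ E') => M' j jin jE u v.
  move=> /map_cat_inv[u1 [u2 [-> u1E u2E]]] /map_cat_inv[v1 [v2 [-> v1E v2E]]].
  apply: TensCat.
    by apply: (EP M' j) => // x xE; apply: jE; rewrite mem_cat xE.
  by apply: (EP' M' j) => // x xE; apply: jE; rewrite !mem_cat xE orbT.
- move=> s t; exists [::] => M' j /ji jm _ u v.
  move=> /map_cat_inv[u1 [u2 [-> <- <-]]] /map_cat_inv[v1 [v2 [-> /jm -> /jm ->]]].
  exact: TensC.
- move=> k; exists [::] => M' j jin _ [|[y l] []] // [|//] [y0 ->] _.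
  by rewrite (jin y 0) ?linear0 //; apply: Tens0.
- move=> x y k; exists [::] => M' j jin _ [|[z l] []] // [|[x' l'] [|[y' l''] []]] //.
  move=> [zE ->] [xE -> yE ->]; rewrite (jin z (x' + y')); first exact: TensDl.
  by rewrite zE linearD xE yE.
- move=> x k k'; exists [::] => M' j jin _ [|[z l] []] // [|[x' l'] [|[y' l''] []]] //.
  move=> [zE ->] [xE -> yE ->]; rewrite (jin z x') ?zE // (jin y' x') ?yE //.
  exact: TensDr.
- move=> a x k; exists [::] => M' j jin _ [|[z l] []] // [|[x' l'] []] //.
  move=> [zE ->] [xE ->]; rewrite (jin z (a *: x')); first exact: TensZ.
  by rewrite zE linearZ xE.
Qed.

Lemma tmapl_class N P (f : {linear N -> P}) M s :
  tmapl f M (tens_class s) = tens_class (map (@on_fst N P M f) s).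
Proof.
rewrite !tens_class_sum linear_sum big_map.
by apply: eq_bigr => p _; rewrite tmaplE.
Qed.

Definition coker_of U V C (f : {linear U -> V}) (p : {linear V -> C}) : Prop :=
  onto p /\ forall v, p v = 0 <-> exists u, f u = v.

Definition fin_pres C : Prop := exists (q p : nat)
  (X : {linear 'rV[A]_q -> 'rV[A]_p}) (pr : {linear 'rV[A]_p -> C}), coker_of X pr.

(** Flatness is tested by finitely presented modules.  If [u] in [L (x) K] dies in
    [P (x) K] with [L] inside [P], it already dies over a finitely generated
    submodule [P'] of [P].  Covering [P'] by a finite free module with kernel [R], the
    lift of [u] becomes a tensor [z] over [R]; the difference lives over a finitely
    generated submodule [S] of the free module, where it vanishes because the
    quotient by [S] is finitely presented.  The map from [S] to [L] then kills [u]. *)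
Lemma flat_fin_pres K : (forall C, fin_pres C -> tor1_zero K C) -> flat K.
Proof.
move=> tK; apply/flatE => L P f fi; apply: lin_eq0_inj; elim/tens_ind=> s.
rewrite tmapl_class => /tens_classP/tens_rel_finitary[E EP].
(* The elements used by the derivation, together with those of the given tensor. *)
have [q [pi [piE _]]] := fg_span (E ++ [seq f p.1 | p <- s]).
have [|P' [j [ji jP]]] := @sub_exists A P [set x | exists v, pi v = x].
  split=> [|a u v]; rewrite !inE /=; first by exists 0; rewrite linear0.
  by move=> [u' <-] [v' <-]; exists (a *: u' + v'); rewrite linearP.
have [|pi' pi'E] := factor_inj (f := pi) ji; first by move=> x; apply/jP; exists x.
have pi'o : onto pi'.
  move=> y; have /jP[v vE] : exists w, j w = j y by exists y.
  by exists v; apply: ji; rewrite pi'E.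
have [|s' s'E] := @lift_fst P' P K j (map (@on_fst L P K f) s).
  move=> x; rewrite -map_comp => xs; apply/jP/piE.
  by rewrite mem_cat [X in _ || X]xs orbT.
have s'0 : tens_class s' = 0 :> tensor P' K.
  apply/tens_classP; apply: (EP P' j) s'E _ => // x xE.
  by apply/jP/piE; rewrite mem_cat xE.
have [|s2 s2E] := @lift_fst 'rV[A]_q P' K pi' s'; first by move=> x _; apply: pi'o.
have [R [r [_ _ rP]]] := short_exact_ker pi'o.
have [|z zE] := @tmapl_exact A R 'rV[A]_q P' r pi' K (tens_class s2) pi'o (fun y => iffLR (rP y)).
  by rewrite tmapl_class s2E.
elim/tens_ind: z zE => z zE.
have [q' [X [XE XQ]]] := fg_span ([seq p.1 | p <- s2] ++ [seq r p.1 | p <- z]).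
have [|S [h [hi hP]]] := @sub_exists A 'rV[A]_q [set x | exists v, X v = x].
  split=> [|a u v]; rewrite !inE /=; first by exists 0; rewrite linear0.
  by move=> [u' <-] [v' <-]; exists (a *: u' + v'); rewrite linearP.
have [s3 s3E] : exists s3, map (@on_fst S 'rV[A]_q K h) s3 = s2.
  by apply: lift_fst => x xs; apply/hP/XE; rewrite mem_cat xs.
have [z3 z3E] : exists z3, map (@on_fst S 'rV[A]_q K h) z3 = map (@on_fst R 'rV[A]_q K r) z.
  apply: lift_fst => x; rewrite -map_comp => xs; apply/hP/XE.
  by rewrite mem_cat [X in _ || X]xs orbT.
have sz : tens_class s3 = tens_class z3 :> tensor S K.
  have [C [pr shp]] := short_exact_coker hi.
  have : fin_pres C.
    exists q', q, X, pr; case: shp => _ pro prP; split=> // v.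
    exact: iff_trans (prP v) (iff_sym (hP v)).
  move=> /tK t; have hK := tor1_zero_inj t shp.
  apply: (iffLR (tmapr_inj_swap K h) hK).
  by rewrite !tmapl_class s3E z3E -zE tmapl_class.
have [|phi phiE] := factor_inj (f := j \o (pi' \o h)) fi.
  move=> x /=; have /hP[v <-] : exists w, h w = h x by exists x.
  apply: (XQ (fun y => exists u, f u = j (pi' y))).
  - by exists 0; rewrite !linear0.
  - by move=> a y y' [u uE] [u' uE']; exists (a *: u + u'); rewrite !linearP uE uE'.
  move=> y; rewrite mem_cat => /orP[/mapP[p ps ->]|/mapP[p pz ->]].
    have : (j (pi' p.1), p.2) \in map (@on_fst L P K f) s.
      by rewrite -s'E -s2E -map_comp; apply/mapP; exists p.
    by case/mapP=> u _ [-> _]; exists u.1.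
  exists 0; rewrite linear0; have -> : pi' (r p.1) = 0 by apply/rP; exists p.1.
  by rewrite linear0.
have : tmapl phi K (tens_class s3) = tmapl phi K (tens_class z3) by rewrite sz.
rewrite !tmapl_class => sz'.
have <- : map (@on_fst S L K phi) s3 = s.
  have: injective (map (@on_fst L P K f)).
    by apply: inj_map => -[x k] [y l] [/fi -> ->].
  apply; rewrite -s'E -s2E -s3E -!map_comp; apply: eq_map => p /=.
  by rewrite /on_fst /= phiE.
rewrite sz' tens_class_sum big_map /= big_seq big1 // => p pz /=.
rewrite (_ : phi p.1 = 0) ?pure0l //.
apply: fi; rewrite phiE linear0 /=.
have : (h p.1, p.2) \in map (@on_fst R 'rV[A]_q K r) z.
  by rewrite -z3E; apply/mapP; exists p.
case/mapP=> x _ [-> _]; rewrite (_ : pi' _ = 0) ?linear0 //.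
by apply/rP; exists x.1.
Qed.

End FiniteFree.

(** * Coherent rings *)

Section Coherent.
Variable A : comNzRingType.
Implicit Types U V W K L M N P F G C T : lmodType A.

Lemma row_mx_linear M p q (f : {linear 'rV[A]_p -> M}) (g : {linear 'rV[A]_q -> M}) :
  linear (fun v : 'rV[A]_(p + q) => f (lsubmx v) + g (rsubmx v)).
Proof.
move=> a x y; rewrite !linearP scalerDr -!addrA; congr (_ + _).
by rewrite addrCA.
Qed.

(** Schanuel's lemma: coherence presents the image ideal on some generators, and
    lifting maps [al], [be] between the two systems of generators carry the
    finiteness of the relations over to the given one. *)
Lemma coherent_ker1 : coherent A -> forall n (X : {linear 'rV[A]_n -> A^o}),
  exists s (Y : {linear 'rV[A]_s -> 'rV[A]_n}), forall v, X v = 0 <-> exists w, Y w = v.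
Proof.
move=> coh n X; pose x := [tuple X (delta_mx 0 j) : A | j < n].
have XE v : X v = \sum_j v 0 j * tnth x j.
  rewrite [v in LHS]row_sum_delta linear_sum; apply: eq_bigr => j _.
  by rewrite linearZ tnth_mktuple.
have [p [q [g [e [eI gE]]]]] := coh n x.
have eP v : e v = 0 <-> exists w, g w = v.
  have : [set v | e v = 0] v <-> range g v by rewrite gE.
  by case=> k1 k2; split=> [/k1[y _ <-]|[y yx]]; [exists y|apply: k2; exists y].
have [|al alE] := dual_basis_lift (p := e) (f := X) (@rV_basis A n).
  move=> v; have : range e (X v) by rewrite eI; exists (fun j => v 0 j); exact: XE.
  by case=> u _ <-; exists u.
have [|be beE] := dual_basis_lift (p := X) (f := e) (@rV_basis A p).
  move=> v; have : ideal_span x (e v) by rewrite -eI; exists v.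
  case=> c ->; exists (\row_j c j); rewrite XE.
  by apply: eq_bigr => j _; rewrite mxE.
have kl : linear (fun v : 'rV[A]_n => v - be (al v)).
  by move=> a u v; rewrite (linearP al) (linearP be) scalerBr opprD addrACA.
exists (q + n)%N, (linear_of (row_mx_linear (be \o g) (linear_of kl))) => v; split.
  move=> v0; have /eP[w wE] : e (al v) = 0 by rewrite alE.
  exists (row_mx w v); rewrite /= row_mxKl row_mxKr wE.
  by rewrite addrC subrK.
move=> [w <-]; rewrite /= linearD beE linearB beE alE subrr addr0.
by apply/eP; exists (lsubmx w).
Qed.

(** Induction on the number of columns: finitely many generators of the relations
    for the first column turn the others into a matrix with one column fewer. *)
Lemma coherent_ker : coherent A -> forall p q (X : {linear 'rV[A]_q -> 'rV[A]_p}),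
  exists s (Y : {linear 'rV[A]_s -> 'rV[A]_q}), forall v, X v = 0 <-> exists w, Y w = v.
Proof.
move=> coh; elim=> [|p IHp] q X.
  exists q, (idfun : {linear 'rV[A]_q -> 'rV[A]_q}) => v; split=> _; first by exists v.
  by apply/rowP=> -[].
have [s [B BP]] := coherent_ker1 coh (row_coord A (0 : 'I_(1 + p)) \o X).
have [s' [Y YP]] := IHp s (@rsubmx A 1 1 p \o (X \o B)).
exists s', (B \o Y) => v; split.
  move=> v0; have /BP[w wE] : (row_coord A (0 : 'I_(1 + p)) \o X) v = 0 by rewrite /= v0 mxE.
  have /YP[u uE] : (@rsubmx A 1 1 p \o (X \o B)) w = 0.
    by rewrite /= wE v0; apply/rowP=> j; rewrite !mxE.
  by exists u; rewrite /= uE.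
move=> [w <-] /=.
have c0 : (row_coord A (0 : 'I_(1 + p)) \o X) (B (Y w)) = 0 by apply/BP; exists (Y w).
have r0 : (@rsubmx A 1 1 p \o (X \o B)) (Y w) = 0 by apply/YP; exists w.
move: c0 r0 => /=; set z := X _; move=> c0 /rowP r0.
apply/rowP=> j; rewrite mxE -[j](@splitK 1 p).
case: (@split 1 p j) => k /=; first by rewrite -[RHS]c0 (ord1 k); congr (z _ _); apply: val_inj.
by have := r0 k; rewrite !mxE.
Qed.

Definition finite_free F := exists n, F = 'rV[A]_n.

Lemma fin_pres_syzygy C : coherent A -> fin_pres C ->
  exists n K (i : {linear K -> 'rV[A]_n}) (p : {linear 'rV[A]_n -> C}),
  short_exact i p /\ fin_pres K.
Proof.
move=> coh [q [n [X [pr [pro prP]]]]].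
have [s [Y YP]] := coherent_ker coh X.
have [K [i sip]] := short_exact_ker pro; exists n, K, i, pr; split=> //.
case: sip => ii _ iP.
have [|g gE] := factor_inj (f := X) ii.
  by move=> v; apply/iP/prP; exists v.
exists s, q, Y, g; split=> [k|v].
  have /prP[v vE] : pr (i k) = 0 by apply/iP; exists k.
  by exists v; apply: ii; rewrite gE.
apply: iff_trans (YP v); rewrite -gE; split=> [->|gv]; first exact: linear0.
by apply: ii; rewrite gv linear0.
Qed.

Lemma fin_pres_syzygies C n : coherent A -> fin_pres C ->
  exists K, syzygy finite_free n C K /\ fin_pres K.
Proof.
move=> coh; elim: n C => [|n IHn] C; first by exists C.
move=> /IHn[K [sK /(fin_pres_syzygy coh)[s [K' [i [p [sip fK']]]]]]].
by exists K'; split=> //; exists K, ('rV[A]_s : lmodType A), i, p; split=> //; exists s.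
Qed.

Lemma finite_free_flat F : finite_free F -> flat F.
Proof. by move=> [n ->]; apply: rV_flat. Qed.

End Coherent.

(** * Linear algebra over a quasilocal ring *)

Section Local.
Variable A : comNzRingType.
Implicit Types U V W K L M N P F G C T : lmodType A.

(** The elementary content of being the unique maximal ideal: the elements outside
    [m] are exactly the units. *)
Definition local_ideal (m : set A) : Prop :=
  [/\ m 0, forall a b, m a -> m b -> m (a + b), forall a b, m b -> m (a * b),
      ~ m 1 & forall a, ~ m a -> exists b, b * a = 1].

Variable m : set A.
Hypothesis ml : local_ideal m.
Let m0 : m 0. Proof. by case: ml. Qed.
Let mD a b : m a -> m b -> m (a + b). Proof. by case: ml => _ + _ _ _; apply. Qed.
Let mM a b : m b -> m (a * b). Proof. by case: ml => _ _ + _ _; apply. Qed.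
Let m1 : ~ m 1. Proof. by case: ml. Qed.
Let mU a : ~ m a -> exists b, b * a = 1. Proof. by case: ml => _ _ _ _; apply. Qed.
Let msum (I : finType) (f : I -> A) : (forall i, m (f i)) -> m (\sum_i f i).
Proof. by move=> mf; elim/big_ind: _ => // x y; apply: mD. Qed.

Lemma local_mulmx p q r (X : 'M[A]_(p, q)) (Y : 'M_(q, r)) :
  (forall i j, m (Y i j)) -> forall i j, m ((X *m Y) i j).
Proof. by move=> mY i j; rewrite mxE; apply: msum => k; apply: mM. Qed.

(** Elimination of one coordinate at a time; each pivot lies in [1 + m], hence is a unit. *)
Lemma nakayama n (v : 'rV[A]_n) (Y : 'M_n) :
  (forall i j, m (Y i j)) -> v = v *m Y -> v = 0.
Proof.
elim: n v Y => [|n IHn] v Y mY; first by move=> _; apply/rowP=> -[].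
have [a [v' vE]] : exists (a : 'M_1) v', v = row_mx a v' :> 'rV_(1 + n).
  by exists (lsubmx (v : 'rV_(1 + n))), (rsubmx (v : 'rV_(1 + n))); rewrite hsubmxK.
pose Z : 'M_(1 + n) := Y.
move=> vY; have : row_mx a v' = row_mx a v' *m Z by rewrite -vE.
rewrite -[Z in _ *m Z]submxK mul_row_block vE => /eq_row_mx[aE v'E].
set Y11 := ulsubmx Z in aE *; set Y21 := dlsubmx Z in aE *.
set Y12 := ursubmx Z in v'E *; set Y22 := drsubmx Z in v'E *.
have [u uE] : exists u, u * (1 - Y11 0 0) = 1.
  apply: mU => m1Y; apply: m1; rewrite -[1](subrK (Y11 0 0)); apply: mD => //.
  by rewrite !mxE.
have aE' : a = u *: (v' *m Y21).
  have : a - a *m Y11 = v' *m Y21 by rewrite {1}aE addrC addKr.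
  rewrite [Y11]mx11_scalar mul_mx_scalar -{1}[a]scale1r -scalerBl => <-.
  by rewrite scalerA uE scale1r.
have v'0 : v' = 0.
  apply: (IHn _ (u *: (Y21 *m Y12) + Y22)) => [i j|].
    rewrite mxE mxE; apply: mD; last by rewrite !mxE.
    by apply: mM; apply: local_mulmx => ? ?; rewrite !mxE.
  by rewrite mulmxDr -scalemxAr mulmxA scalemxAl -aE' -v'E.
by rewrite aE' v'0 mul0mx scaler0 row_mx0.
Qed.

(** Row by row Gaussian elimination modulo [m]: either a row becomes dependent on
    those already treated, or an invertible pivot extends the right inverse. *)
Lemma split_or_degenerate r s (Z : 'M[A]_(r, s)) :
  (exists (w : 'rV_r) j, ~ m (w 0 j) /\ forall k, m ((w *m Z) 0 k)) \/
  exists B, Z *m B = 1%:M.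
Proof.
elim: r Z => [|r IHr] Z; first by right; exists 0; apply/matrixP=> -[].
pose Y : 'M_(1 + r, s) := Z.
pose z := usubmx Y; pose Z' := dsubmx Y.
have [[w [j [wj wZ]]]|[B BE]] := IHr Z'.
  left; exists (row_mx (0 : 'M_1) w : 'rV_(1 + r)), (rshift 1 j); split.
    by move: wj; rewrite -(row_mxEr (0 : 'M_1) w).
  have E : row_mx (0 : 'M_1) w *m Y = w *m Z'.
    by rewrite -[Y]vsubmxK mul_row_col mul0mx add0r.
  by move=> k; have := wZ k; rewrite -E.
(* The first row, reduced modulo the others by means of the right inverse [B]. *)
pose z1 := z - z *m B *m Z'.
have [mz1|] := pselect (forall k, m (z1 0 k)).
  left; exists (row_mx (1%:M : 'M_1) (- (z *m B)) : 'rV_(1 + r)), (lshift r (0 : 'I_1)).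
  split; first by rewrite (_ : _ 0 _ = 1) // [LHS]row_mxEl !mxE.
  have E : row_mx (1%:M : 'M_1) (- (z *m B)) *m Y = z1.
    by rewrite -[Y]vsubmxK mul_row_col mul1mx mulNmx.
  by move=> k; have := mz1 k; rewrite -E.
move=> /existsNP[k /mU[u uE]]; right.
pose e : 'cV_s := u *: delta_mx k 0.
pose b := e - B *m (Z' *m e).
have Z'b : Z' *m b = 0 by rewrite mulmxBr (mulmxA Z' B) BE mul1mx subrr.
have z1B : z1 *m B = 0 by rewrite mulmxBl -(mulmxA _ Z' B) BE mulmx1 subrr.
have z1b : z1 *m b = 1%:M.
  rewrite mulmxBr (mulmxA z1 B) z1B mul0mx subr0 -scalemxAr -colE.
  apply/matrixP=> i j; rewrite !ord1 [RHS]mxE /= [RHS](_ : _ = 1) // -[RHS]uE mxE.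
  by congr (u * _); rewrite mxE.
have zb : z *m b = 1%:M.
  by rewrite -[z](subrK (z *m B *m Z')) mulmxDl z1b -!mulmxA Z'b !mulmx0 addr0.
exists (row_mx b (B - b *m (z *m B)) : 'M_(s, 1 + r)).
clearbody b; suff : Y *m row_mx b (B - b *m (z *m B)) = 1%:M by [].
rewrite -[Y]vsubmxK mul_col_row -/z -/Z'.
rewrite !mulmxBr !mulmxA Z'b BE zb mul1mx !mul0mx !subrr subr0.
by rewrite -scalar_mx_block.
Qed.

(** With a generating family of minimal size the entries of every relation lie in
    [m].  For a relation [l], flatness applied to the ideal [I] of its entries gives
    [sum_j l_j (x) g(e_j) = 0] in [I (x) T], which means that [l] is a combination,
    with its own entries as coefficients, of relations; so [l = l Y] with the entries
    of [Y] in [m], and Nakayama's lemma gives [l = 0]. *)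
Lemma fg_flat_free T r (g : {linear 'rV[A]_r -> T}) : onto g -> flat T ->
  exists r' (g' : {linear 'rV[A]_r' -> T}), injective g' /\ onto g'.
Proof.
move=> + Tf; elim: r g => [|r IHr] g go.
  by exists 0%N, g; split=> //; apply: lin_eq0_inj => x _; apply/rowP=> -[].
(* A relation with an invertible entry makes one generator redundant. *)
have [[y [j [gy /mU[u uE]]]]|noU] :=
    pselect (exists y j, g y = 0 /\ ~ m (y 0 j)).
  have il : linear (fun z : 'rV[A]_r =>
      \row_k (if unlift j k is Some k' then z 0 k' else 0) : 'rV[A]_r.+1).
    by move=> a v w; apply/rowP=> k; rewrite !mxE; case: unliftP => [k'|] _;
      rewrite ?mxE ?mulr0 ?addr0.
  apply: (IHr (g \o linear_of il)) => t; have [v <-] := go t.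
  exists (\row_k (v - (v 0 j * u) *: y) 0 (lift j k)) => /=.
  rewrite (_ : \row_k _ = v - (v 0 j * u) *: y).
    by rewrite linearB linearZ /= gy scaler0 subr0.
  apply/rowP=> k; rewrite !mxE; case: unliftP => [k'|] ->; rewrite ?mxE //.
  by rewrite -mulrA uE mulr1 subrr.
have gm y j : g y = 0 -> m (y 0 j).
  by move=> gy; apply: contrapT => yj; apply: noU; exists y, j.
exists r.+1, g; split=> //; apply: lin_eq0_inj => l gl.
(* The ideal [I] generated by the entries of [l]. *)
have [|I [io [ioi ioP]]] := @sub_exists A A^o [set a | exists c : 'rV_r.+1, a = \sum_j c 0 j * l 0 j].
  split=> [|a u v]; rewrite !inE /=.
    by exists 0; rewrite big1 // => j _; rewrite mxE mul0r.
  move=> [c ->] [c' ->]; exists (a *: c + c').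
  rewrite [a *: _]mulr_sumr -big_split; apply: eq_bigr => j _ /=.
  by rewrite !mxE mulrDl mulrA.
have lamex j : exists x, io x = l 0 j.
  apply/ioP; exists (delta_mx 0 j).
  rewrite (bigD1 j) //= mxE !eqxx mul1r big1 ?addr0 // => k kj.
  by rewrite mxE (negPf kj) andbF mul0r.
have [lam lamE] := choice lamex.
pose om := \sum_j pure (lam j) (g (delta_mx 0 j)).
have om0 : om = 0.
  move/flatE: Tf => /(_ _ _ _ ioi); apply; rewrite linear0 linear_sum.
  transitivity (pure (1 : A^o) (g l)); last by rewrite gl pure0r.
  rewrite [l in RHS]row_sum_delta linear_sum pure_sumr; apply: eq_bigr => j _.
  by rewrite tmaplE lamE linearZ pureZr -pureZl; congr pure; exact: (esym (mulr1 _)).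
(* The submodule [I . ker g]: the kernel of the map from [I^r] to [I (x) T]. *)
have [|W [h [_ hP]]] := @sub_exists A 'rV[A]_r.+1
    [set v | exists Y : 'M_r.+1, (forall i, g (row i Y) = 0) /\ v = l *m Y].
  split=> [|a u v]; rewrite !inE /=.
    by exists 0; split=> [i|]; rewrite ?row0 ?linear0 ?mulmx0.
  move=> [Y [Y0 ->]] [Y' [Y0' ->]]; exists (a *: Y + Y'); split=> [i|].
    by rewrite linearP linearP Y0 Y0' scaler0 addr0.
  by rewrite mulmxDr scalemxAr.
have [C [pr [_ prP]]] := coker_exists h.
have pr0 v : pr v = 0 <-> exists Y : 'M_r.+1, (forall i, g (row i Y) = 0) /\ v = l *m Y.
  exact: iff_trans (prP v) (iff_sym (hP v)).
have prI a y : g y = 0 -> pr ((io a : A) *: y) = 0.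
  move=> gy; apply/pr0; have /ioP[c ->] : exists b, io b = io a by exists a.
  exists (\matrix_(i, k) (c 0 i * y 0 k)); split=> [i|].
    rewrite (_ : row i _ = c 0 i *: y) ?linearZ /= ?gy ?scaler0 //.
    by apply/rowP=> k; rewrite !mxE.
  apply/rowP=> k; rewrite !mxE mulr_suml; apply: eq_bigr => i _.
  by rewrite mxE mulrCA mulrA.
have [s sK] := choice go.
pose b (a : I) (t : T) := pr ((io a : A) *: s t).
have bE a v : b a (g v) = pr ((io a : A) *: v).
  apply/subr0_eq; rewrite -linearB -scalerBr prI //.
  by rewrite linearB sK subrr.
have bb : bilinear_map b.
  split=> [t a u v|a c u v].
    by rewrite /b linearP scalerDl linearD -scalerA linearZ.
  rewrite -[u]sK -[v]sK -linearP !bE -(linearP pr) scalerDr !scalerA.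
  by rewrite mulrC.
have : pr l = 0.
  rewrite -[RHS](linear0 (tlift bb)) -om0 linear_sum [l in LHS]row_sum_delta linear_sum.
  by apply: eq_bigr => j _; rewrite tlift_pure bE lamE.
move/pr0=> [Y [Y0 lE]]; apply: nakayama lE => i j.
by have := gm _ j (Y0 i); rewrite mxE.
Qed.

(** Otherwise [Z] has a right inverse, and the cokernel is a direct summand of the
    free module. *)
Lemma coker_not_flat r s (Z : 'M[A]_(r, s)) P (p : {linear 'rV[A]_s -> P}) :
  coker_of (mulmxr Z : {linear 'rV[A]_r -> 'rV[A]_s}) p -> ~ flat P ->
  exists (w : 'rV_r) j, ~ m (w 0 j) /\ forall k, m ((w *m Z) 0 k).
Proof.
move=> [po pP] Pnf; have [//|[B ZB]] := split_or_degenerate Z; case: Pnf.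
(* The projection along the row space of [Z] induces a section of [p]. *)
have sl : linear (fun x : 'rV[A]_s => x - x *m B *m Z).
  by move=> a x y; rewrite !mulmxDl -!scalemxAl scalerBr opprD addrACA.
have [|sg sgE] := factor_onto (f := linear_of sl) po.
  move=> x /pP[w <-] /=; rewrite -(mulmxA w) ZB mulmx1 subrr //.
apply: (@dual_basis_flat A P _ (fun k => p (delta_mx 0 k)) (fun k => row_coord A k \o sg)) => y.
have [x <-] := po y.
under eq_bigr => k _ do rewrite /= sgE -linearZ /=.
rewrite -linear_sum -row_sum_delta linearB /= (_ : p (_ *m Z) = 0) ?subr0 //.
by apply/pP; exists (x *m B).
Qed.

End Local.

(** * The Koszul complex *)

Section KoszulComplex.
Variables (A : comNzRingType) (n : nat) (x : n.-tuple A).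
Implicit Types U V W K L M N P F G C T : lmodType A.
Implicit Types (S R : {set 'I_n}) (i : nat) (j l : 'I_n) (h : {set 'I_n} -> A).

(** Chains extended by zero to all subsets of the index set; signs and differentials
    are then computed on plain functions of sets, without cardinality constraints. *)
Definition kext i (f : koszul A n i) S : A :=
  if insub S is Some s then f s else 0.

Definition kres i h : koszul A n i := [ffun s => h (val s)].

Definition ksgn j S : A := (-1) ^+ #|[pred k in S | (k < j)%N]|.

Definition fun_diff h S : A := \sum_(j | j \notin S) ksgn j S * tnth x j * h (j |: S).

Definition fun_wedge j h S : A := if j \in S then ksgn j (S :\ j) * h (S :\ j) else 0.

Lemma kext_card i (f : koszul A n i) S : #|S| != i -> kext f S = 0.
Proof. by move=> Si; rewrite /kext insubN. Qed.

Lemma kext_val i (f : koszul A n i) s : kext f (val s) = f s.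
Proof. by rewrite /kext valK. Qed.

Lemma kext_inj i (f g : koszul A n i) : kext f =1 kext g -> f = g.
Proof. by move=> fg; apply/ffunP=> s; rewrite -!kext_val fg. Qed.

Lemma kextK i h : (forall S, #|S| != i -> h S = 0) -> kext (kres i h) =1 h.
Proof.
move=> h0 S; have [Si|/[dup] Si /h0 ->] := eqVneq #|S| i; last by rewrite kext_card.
have Si' : #|S| == i by apply/eqP.
by rewrite -[S]/(val (exist (fun S => #|S| == i) S Si')) kext_val ffunE.
Qed.

Lemma kextP i a (f g : koszul A n i) S :
  kext (a *: f + g) S = a * kext f S + kext g S.
Proof.
by rewrite /kext; case: insub => [s|]; rewrite ?mulr0 ?addr0 // !ffunE.
Qed.

Lemma kext_diff i (f : koszul A n i.+1) : kext (koszul_diff x f) =1 fun_diff (kext f).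
Proof.
move=> S; have [Si|Si] := boolP (#|S| == i); last first.
  rewrite kext_card // /fun_diff big1 // => j jS.
  by rewrite kext_card ?mulr0 // cardsU1 jS.
rewrite -[S]/(val (exist (fun S => #|S| == i) S Si)) kext_val ffunE /= /fun_diff.
rewrite (exchange_big_dep (fun j => j \notin S)) /=; last by move=> ? ? _ /andP[].
apply: eq_bigr => j jS.
have jSi : #|j |: S| == i.+1 by rewrite cardsU1 jS.
pose s := exist (fun S => #|S| == i.+1) (j |: S) jSi.
rewrite (big_pred1 s) => [|s']; last by rewrite /= jS /= -(inj_eq val_inj).
by rewrite -[j |: S]/(val s) kext_val.
Qed.

Lemma koszul_diff_linear i : linear (@koszul_diff A n i x).
Proof.
move=> a f g; apply: kext_inj => S; rewrite kextP !kext_diff /fun_diff mulr_sumr -big_split.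
by apply: eq_bigr => j _ /=; rewrite kextP mulrDr mulrCA.
Qed.
Definition kdiff i : {linear koszul A n i.+1 -> koszul A n i} := linear_of (@koszul_diff_linear i).

Lemma ksgnU j l S : j \notin S -> j != l ->
  ksgn l (j |: S) = (if (j < l)%N then -1 else 1) * ksgn l S.
Proof.
move=> jS jl; rewrite /ksgn.
have [jltl|jgel] := boolP (j < l)%N.
  rewrite -exprS -(_ : #|[set k in j |: S | (k < l)%N]| = _.+1); last first.
    rewrite (_ : [set k in _ | _] = j |: [set k in S | (k < l)%N]).
      rewrite cardsU1 inE (negPf jS) /= add1n; congr _.+1.
      by apply: eq_card => k; rewrite !inE.
    by apply/setP=> k; rewrite !inE; case: eqP => // ->; rewrite jltl.
  by congr (_ ^+ _); apply: eq_card => k; rewrite !inE.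
rewrite mul1r; congr (_ ^+ _); apply: eq_card => k; rewrite !inE.
by case: eqP => // ->; rewrite (negPf jgel) (negPf jS).
Qed.

(** Removing [j] and [l] in the two possible orders gives opposite signs. *)
Lemma ksgnC j l S : j \notin S -> l \notin S -> j != l ->
  ksgn j S * ksgn l (j |: S) = - (ksgn l S * ksgn j (l |: S)).
Proof.
move=> jS lS jl; rewrite !ksgnU // 1?eq_sym //.
case: ltngtP => [||/val_inj e]; last by rewrite e eqxx in jl.
  by rewrite mul1r mulN1r mulrN mulrC.
by rewrite mul1r mulN1r mulrN opprK mulrC.
Qed.

Lemma ksgnUU j l S : j \notin S -> l \notin S -> j != l ->
  ksgn l (j |: S) * ksgn j (l |: S) = - (ksgn j S * ksgn l S).
Proof.
move=> jS lS jl; rewrite !ksgnU // 1?eq_sym //.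
case: ltngtP => [||/val_inj e]; last by rewrite e eqxx in jl.
  by rewrite mul1r mulN1r mulNr mulrC.
by rewrite mul1r mulN1r mulrN mulrC.
Qed.

(** The terms are paired off through [j < l]; dividing by two would fail in
    characteristic two. *)
Lemma sum_antisym (p : 'I_n -> 'I_n -> bool) (a : 'I_n -> 'I_n -> A) :
  (forall j l, p j l -> j != l) -> (forall j l, p j l = p l j) ->
  (forall j l, p j l -> a j l = - a l j) ->
  \sum_j \sum_(l | p j l) a j l = 0.
Proof.
move=> pN pC aN.
transitivity (\sum_j \sum_(l | p j l && (j < l)%N) a j l +
              \sum_j \sum_(l | p j l && ~~ (j < l)%N) a j l).
  by rewrite -big_split; apply: eq_bigr => j _; rewrite [LHS](bigID (fun l => (j < l)%N)).
rewrite [X in _ + X](exchange_big_dep xpredT) //=.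
rewrite -big_split big1 //= => j _.
rewrite [X in _ + X](eq_big (fun l => p j l && (j < l)%N) (fun l => - a j l)).
- by rewrite sumrN subrr.
- move=> l; rewrite pC; have [/pN jl|//] := boolP (p j l).
  by rewrite -leqNgt ltn_neqAle jl.
- by move=> l /andP[/aN].
Qed.

Lemma fun_diff_diff h : fun_diff (fun_diff h) =1 fun=> 0.
Proof.
move=> S; rewrite /fun_diff.
transitivity (\sum_j \sum_(l | [&& j != l, j \notin S & l \notin S])
   ksgn j S * ksgn l (j |: S) * (tnth x j * tnth x l) * h (l |: (j |: S))).
  rewrite [RHS](bigID (fun j => j \notin S)) /= [X in _ + X]big1 ?addr0; last first.
    by move=> j jS; rewrite big_pred0 // => l; rewrite (negPf jS) andbF.
  apply: eq_bigr => j jS; rewrite mulr_sumr.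
  apply: eq_big => [l|l _]; first by rewrite !inE negb_or jS eq_sym.
  by rewrite !mulrA; congr (_ * _); rewrite -!mulrA; congr (_ * _); rewrite mulrCA.
apply: sum_antisym => [j l /and3P[]//|j l|j l /and3P[jl jS lS]].
  by rewrite eq_sym [X in _ && X]andbC.
rewrite ksgnC // !mulNr; congr (- (_ * _ * _)); first by rewrite mulrC.
by rewrite finset.setUCA.
Qed.

Lemma kdiff_kdiff i (z : koszul A n i.+2) : kdiff i (kdiff i.+1 z) = 0.
Proof.
apply: kext_inj => S; rewrite kext_diff.
transitivity (fun_diff (fun_diff (kext z)) S).
  by apply: eq_bigr => j _; rewrite kext_diff.
by rewrite fun_diff_diff /kext; case: insub => // s; rewrite ffunE.
Qed.

Lemma kwedge_linear i j : linear (fun f : koszul A n i => kres i.+1 (fun_wedge j (kext f))).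
Proof.
move=> a f g; apply/ffunP => s; rewrite !ffunE /fun_wedge.
case: ifP => _; last by rewrite addr0 [RHS]mulr0.
by rewrite kextP mulrDr mulrCA.
Qed.
Definition kwedge i j : {linear koszul A n i -> koszul A n i.+1} := linear_of (@kwedge_linear i j).

Lemma kext_kwedge i j (f : koszul A n i) : kext (kwedge i j f) =1 fun_wedge j (kext f).
Proof.
apply: kextK => S Si; rewrite /fun_wedge; case: ifP => // jS.
by rewrite kext_card ?mulr0 //; apply: contra Si => /eqP <-; rewrite [#|S|](cardsD1 j) jS.
Qed.

Lemma ksgn2 j S : ksgn j S * ksgn j S = 1.
Proof. by rewrite -expr2 /ksgn -exprM mulnC exprM sqrrN !expr1n. Qed.

(** The contracting homotopy: exterior multiplication by [e_j] is a homotopy between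
    multiplication by [x_j] and zero. *)
Lemma fun_diff_wedge h j S : fun_diff (fun_wedge j h) S + fun_wedge j (fun_diff h) S = tnth x j * h S.
Proof.
rewrite /fun_diff {1 2}/fun_wedge; have [jS|jS] := boolP (j \in S); last first.
  rewrite addr0 (bigD1 j) //= !inE eqxx /= finset.setU1K // [X in _ + X]big1 ?addr0.
    by rewrite mulrACA ksgn2 mul1r.
  by move=> l /andP[lS lj]; rewrite !inE eq_sym (negPf lj) (negPf jS) mulr0.
rewrite [X in _ + _ * X](bigD1 j) /=; last by rewrite !inE eqxx.
rewrite finset.setD1K // mulrDr !mulrA ksgn2 mul1r.
rewrite addrCA -[RHS]addr0; congr (_ + _); rewrite mulr_sumr.
rewrite [X in _ + X](eq_bigl (fun l => l \notin S)); last first.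
  move=> l; rewrite !inE; have [->|_] := eqVneq l j; first by rewrite jS.
  by rewrite andbT.
rewrite -big_split big1 //= => l lS.
have lj : l != j by apply: contraNneq lS => ->.
rewrite inE jS orbT.
have -> : (l |: S) :\ j = l |: (S :\ j).
  rewrite finset.setDUl; congr (_ :|: _); apply/setP=> k; rewrite !inE.
  by have [->|_] := eqVneq k l; rewrite ?lj ?andbF.
have := @ksgnUU j l (S :\ j); rewrite !inE eqxx (negPf lS) andbF eq_sym lj finset.setD1K //.
move=> /(_ isT isT isT) sC.
by rewrite mulrACA sC mulNr !mulrA addNr.
Qed.

Lemma kwedge_homotopy0 j (z : koszul A n 0) : kdiff 0 (kwedge 0 j z) = tnth x j *: z.
Proof.
apply: kext_inj => S; rewrite -[_ *: z]addr0 kextP kext_diff.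
rewrite (_ : kext 0 S = 0) ?addr0; last by rewrite /kext; case: insub => // s; rewrite ffunE.
transitivity (fun_diff (fun_wedge j (kext z)) S); first by apply: eq_bigr => l _; rewrite kext_kwedge.
have [S0|Sn0] := eqVneq #|S| 0%N; last first.
  rewrite (kext_card z) // mulr0 /fun_diff big1 // => l lS.
  rewrite -kext_kwedge kext_card ?mulr0 // cardsU1 lS add1n.
  by apply: contra Sn0 => /eqP[->].
rewrite -(fun_diff_wedge _ j S) /fun_wedge [X in _ + X]ifN ?addr0 //.
by move/eqP: S0; rewrite cards_eq0 => /eqP ->; rewrite inE.
Qed.

Lemma kwedge_homotopy i j (z : koszul A n i.+1) :
  kdiff i.+1 (kwedge i.+1 j z) + kwedge i j (kdiff i z) = tnth x j *: z.
Proof.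
apply: kext_inj => S; rewrite -[_ *: z]addr0 -[X in kext (X + _)]scale1r !kextP.
rewrite kext_diff kext_kwedge.
rewrite (_ : kext 0 S = 0) ?addr0; last by rewrite /kext; case: insub => // s; rewrite ffunE.
rewrite -(fun_diff_wedge _ j S) mul1r; congr (_ + _).
  by apply: eq_bigr => l _; rewrite kext_kwedge.
rewrite /fun_wedge; case: ifP => // _; congr (_ * _); exact: kext_diff.
Qed.

Definition kbase i (s : {S : {set 'I_n} | #|S| == i}) : koszul A n i :=
  [ffun s' => (s' == s)%:R].
Lemma kcoord_linear i (s : {S : {set 'I_n} | #|S| == i}) :
  linear (fun f : koszul A n i => f s : A^o).
Proof. by move=> a f g; rewrite !ffunE. Qed.
Definition kcoord i s : {linear koszul A n i -> A^o} := linear_of (@kcoord_linear i s).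

Lemma koszul_basis i : dual_basis (@kbase i) (@kcoord i).
Proof.
move=> f; apply/ffunP => s; rewrite sum_ffunE (bigD1 s) //= big1 ?addr0.
  by rewrite !ffunE eqxx; symmetry; apply: mulr1.
by move=> s' ss'; rewrite !ffunE eq_sym (negPf ss'); apply: mulr0.
Qed.

Lemma koszul_flat i : flat (koszul A n i).
Proof. exact (dual_basis_flat (@koszul_basis i)). Qed.

Lemma kdiff_ideal (m : set A) i (z : koszul A n i.+1) s : m 0 ->
  (forall a b, m a -> m b -> m (a + b)) -> (forall a b, m b -> m (a * b)) ->
  (forall j, m (tnth x j)) -> m (kdiff i z s).
Proof.
move=> m0 mD mM mx; rewrite /= ffunE.
elim/big_ind: _ => // S _; elim/big_ind: _ => // j _.
by rewrite mulrC; apply/mM/mM.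
Qed.

End KoszulComplex.

(** * Koszul cohomology and acyclicity below the top syzygy *)

Section KoszulCohomology.
Variables (A : comNzRingType) (n : nat) (x : n.-tuple A).
Implicit Types U V W K L M N P F G C T Q : lmodType A.

(** [koszul_coboundary] for plain functions; only their values matter. *)
Definition coboundary i M : (koszul A n i -> M) -> Prop :=
  match i with
  | 0 => fun f => forall z, f z = 0
  | i'.+1 => fun f => exists psi : {linear koszul A n i' -> M}, forall z, f z = psi (kdiff x i' z)
  end.

Lemma coboundaryE i M (phi : {linear koszul A n i -> M}) : koszul_coboundary x phi <-> coboundary phi.
Proof. by case: i phi. Qed.

Lemma cocycleE i M (phi : {linear koszul A n i -> M}) :
  koszul_cocycle x phi <-> forall z, phi (kdiff x i z) = 0.
Proof. by []. Qed.

Definition koszul_zero_at M i := forall phi : {linear koszul A n i -> M},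
  (forall z, phi (kdiff x i z) = 0) -> coboundary phi.

Lemma koszul_zero_atP M i : koszul_cohomology_neq0 x M i <-> ~ koszul_zero_at M i.
Proof.
split=> [[phi [/cocycleE c /coboundaryE nc]] v|nv]; first exact/nc/v.
apply: contrapT => ne; apply: nv => phi c; apply: contrapT => nc; apply: ne.
by exists phi; split; [apply/cocycleE|move=> /coboundaryE].
Qed.

Lemma coboundary_comp i M N (f : koszul A n i -> M) (h : {linear M -> N}) :
  coboundary f -> coboundary (fun z => h (f z)).
Proof.
case: i f => [|i] f /=; first by move=> f0 z; rewrite f0 linear0.
by move=> [psi fE]; exists (h \o psi) => z; rewrite fE.
Qed.

Lemma coboundary_ext i M (f g : koszul A n i -> M) : f =1 g -> coboundary f -> coboundary g.
Proof.
case: i f g => [|i] f g fg /=; first by move=> f0 z; rewrite -fg.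
by move=> [psi fE]; exists psi => z; rewrite -fg.
Qed.

Lemma scale_linear M a : linear (fun v : M => a *: v).
Proof. by move=> b u v; rewrite scalerDr !scalerA mulrC. Qed.
Definition scale_lin M a : {linear M -> M} := linear_of (@scale_linear M a).

Lemma coboundary_scale i M (f : koszul A n i -> M) a : coboundary f -> coboundary (fun z => a *: f z).
Proof. exact: (@coboundary_comp i M M f (scale_lin M a)). Qed.

Lemma coboundary0 i M : coboundary (fun _ : koszul A n i => 0 : M).
Proof. by case: i => [|i] //=; exists (@zero_lin A _ _) => z. Qed.

Lemma coboundaryD i M (f g : koszul A n i -> M) : coboundary f -> coboundary g -> coboundary (fun z => f z + g z).
Proof.
case: i f g => [|i] f g /=; first by move=> f0 g0 z; rewrite f0 g0 addr0.
by move=> [p pE] [q qE]; exists (p \+ q) => z; rewrite pE qE.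
Qed.

(** By the homotopy [kwedge_homotopy], every [x_j] annihilates Koszul cohomology. *)
Lemma coboundary_ideal i M (phi : {linear koszul A n i -> M}) a :
  (forall z, phi (kdiff x i z) = 0) -> ideal_span x a -> coboundary (fun z => a *: phi z).
Proof.
move=> c [b ->]; apply: (@coboundary_ext _ _ (fun z => \sum_j b j *: (tnth x j *: phi z))).
  by move=> z; rewrite scaler_suml; apply: eq_bigr => j _; rewrite scalerA.
have cj j : coboundary (fun z => b j *: (tnth x j *: phi z)).
  apply: coboundary_scale; case: i phi c => [|i] phi c.
    by move=> z; rewrite -linearZ -(kwedge_homotopy0 x) c.
  exists (phi \o kwedge A i j) => z /=.
  by rewrite -linearZ -(kwedge_homotopy x) linearD [X in X + _]c add0r.
elim: (index_enum _) => [|j s IHs].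
  by apply: coboundary_ext (coboundary0 i M) => z; rewrite big_nil.
by apply: coboundary_ext (coboundaryD (cj j) IHs) => z; rewrite big_cons.
Qed.

Lemma coboundary_coord i s (f : {linear koszul A n i -> 'rV[A]_s}) :
  (forall k, coboundary (fun z => row_coord A k (f z))) -> coboundary f.
Proof.
case: i f => [|i] f /=; first by move=> f0 z; apply/rowP=> k; rewrite mxE; exact: f0.
move=> /choice[psi fE].
have pl : linear (fun z => \row_k (psi k z : A)).
  by move=> a u v; apply/rowP => k; rewrite !mxE linearP.
by exists (linear_of pl) => z; apply/rowP => k; rewrite mxE -fE.
Qed.

Lemma koszul_zero_at_free i s : koszul_zero_at A^o i -> koszul_zero_at 'rV[A]_s i.
Proof.
move=> v f c; apply: coboundary_coord => k.
by apply: (v (row_coord A k \o f)) => z /=; rewrite c mxE.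
Qed.

(** The map H^g(K) -> H^g(F) is injective as soon as H^(g-1)(Q) = 0: this is the long
    exact cohomology sequence.  A cochain [psi] bounding the image of [phi] maps to
    a cocycle in [Q], hence to a coboundary, whose lift to [F] corrects [psi] to a
    cochain [psi0] with values in [K]. *)
Lemma coboundary_short_exact K F Q (j : {linear K -> F}) (p : {linear F -> Q}) g :
  short_exact j p -> (forall k, (k < g)%N -> koszul_zero_at Q k) ->
  forall phi : {linear koszul A n g -> K}, coboundary (fun z => j (phi z)) -> coboundary phi.
Proof.
move=> [ji po pP] Qv phi; have pj k : p (j k) = 0 by apply/pP; exists k.
case: g phi Qv => [|g] phi Qv /=.
  by move=> c z; apply: ji; rewrite c linear0.
move=> [psi psiE].
(* Any cocycle [th] of [F] with the image of [psi] in [Q] corrects [psi]. *)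
have key (th : {linear koszul A n g -> F}) : (forall z, th (kdiff x g z) = 0) ->
    (forall z, p (psi z) = p (th z)) ->
    exists psi0 : {linear koszul A n g -> K}, forall z, phi z = psi0 (kdiff x g z).
  move=> th0 pth.
  have [|psi0 psi0E] := factor_inj (f := psi \- th) ji.
    by move=> z; apply/pP; rewrite /= linearB pth subrr.
  exists psi0 => z; apply: ji; rewrite psi0E psiE.
  by rewrite -[LHS]subr0 -(th0 z).
have cpsi : coboundary (fun z => p (psi z)).
  by apply: (Qv g (ltnSn g) (p \o psi)) => z; rewrite /= -psiE pj.
case: g phi Qv psi psiE cpsi key => [|g] phi Qv psi psiE /= cpsi key.
  by apply: (key (@zero_lin A _ _)) => // z; rewrite cpsi [RHS]linear0.
have [th thE] := cpsi.
have [|th' th'E] := dual_basis_lift (p := p) (f := th) (@koszul_basis A n g).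
  by move=> z; apply: po.
apply: (key (th' \o kdiff x g)) => z /=; first by rewrite [X in th' X]kdiff_kdiff linear0.
by rewrite thE -th'E.
Qed.

(** Each step of the resolution gains one degree of vanishing, up to that of [A]. *)
Lemma koszul_zero_at_syzygy C P s g : syzygy (@finite_free A) s C P ->
  (forall k, (k < g)%N -> koszul_zero_at A^o k) ->
  forall k, (k < s)%N -> (k < g)%N -> koszul_zero_at P k.
Proof.
move=> + Av; elim: s P => [|s IHs] P //=.
move=> [Q [F [j [p [sjp [r Fr] sQ]]]]] k ks kg phi c; subst F.
have Qv k' : (k' < k)%N -> koszul_zero_at Q k'.
  move=> k'k; apply: IHs => //; first exact: leq_trans k'k _.
  exact: ltn_trans kg.
apply: (coboundary_short_exact sjp Qv).
have Fv : koszul_zero_at 'rV[A]_r k by apply: koszul_zero_at_free; exact: Av.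
by apply: (Fv (j \o phi)) => z; rewrite /= c linear0.
Qed.

(** The elements of [ts] act as commuting nilpotent operators on cohomology, so a
    nonzero class has a nonzero multiple that they all annihilate. *)
Lemma killed_class (ts : seq A) i M (phi : {linear koszul A n i -> M}) :
  (forall t, t \in ts -> exists k, ideal_span x (t ^+ k)) ->
  (forall z, phi (kdiff x i z) = 0) -> ~ coboundary phi ->
  exists phi' : {linear koszul A n i -> M},
  [/\ forall z, phi' (kdiff x i z) = 0, ~ coboundary phi' &
      forall t, t \in ts -> coboundary (fun z => t *: phi' z)].
Proof.
move=> + c nc; elim: ts => [|t ts IHts] tx; first by exists phi.
have [|phi' [c' nc' tc']] := IHts.
  by move=> u uts; apply: tx; rewrite inE uts orbT.
have [k xk] : exists k, ideal_span x (t ^+ k) by apply: tx; rewrite inE eqxx.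
have ex : exists k, `[< coboundary (fun z => t ^+ k *: phi' z) >].
  by exists k; apply/asboolP/coboundary_ideal.
case: (ex_minnP ex) => -[|l] /asboolP tl lmin.
  by case: nc'; apply: coboundary_ext tl => z; rewrite expr0 scale1r.
exists (scale_lin M (t ^+ l) \o phi'); split=> [z||u].
- by rewrite /= c' scaler0.
- by move=> cl; have := lmin l; rewrite ltnn => lt; have := lt (introT (asboolP _) cl).
- rewrite inE => /predU1P[->|/tc' cu].
    by apply: coboundary_ext tl => z; rewrite /= scalerA -exprS.
  by apply: coboundary_ext (coboundary_scale (t ^+ l) cu) => z; rewrite /= !scalerA mulrC.
Qed.

Variable m : set A.
Hypothesis ml : local_ideal m.

Lemma coboundary_local i (f : koszul A n i -> A^o) :
  (forall j, m (tnth x j)) -> coboundary f -> forall z, m (f z).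
Proof.
case: ml => m0 mD mM _ _ mx; case: i f => [|i] f /=; first by move=> f0 z; rewrite f0.
move=> [psi fE] z; rewrite fE -[X in psi X]/(kdiff x i z) (koszul_basis (kdiff x i z)) linear_sum.
elim/big_ind: _ => // s _; rewrite linearZ; set b := psi _.
have mZ (a : A) (y : A^o) : m a -> m (a *: y).
  by move=> ma; rewrite (_ : a *: y = (y : A) * a); [apply: mM|apply: mulrC].
by apply: mZ; apply: kdiff_ideal.
Qed.

(** The top cohomology is the quotient of [A] by the ideal of [x], which is proper. *)
Lemma koszul_top_nonzero : (forall j, m (tnth x j)) -> ~ koszul_zero_at A^o n.
Proof.
move=> mx v; case: (ml) => _ _ _ m1 _; apply: m1.
have top : #|[set: 'I_n]%SET| == n by rewrite cardsT card_ord.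
pose s : {S : {set 'I_n} | #|S| == n} := exist _ [set: 'I_n]%SET top.
have <- : kcoord A s (kbase A s) = 1 by rewrite /= ffunE eqxx.
apply: coboundary_local => //; apply: v => z; rewrite (_ : kdiff x n z = 0) ?linear0 //.
rewrite (_ : z = 0) ?linear0 //; apply/ffunP => -[S Sn].
by have := max_card (mem S); rewrite card_ord (eqP Sn) ltnn.
Qed.

(** Take the least degree [g] with a nonzero class, replaced by a class [phi'] killed
    by the coordinates of [w Z].  Then [phi' w] is a class with values in the free
    syzygy whose image in the next free module vanishes; as [P] is an [s]-th syzygy,
    H^(g-1)(P) = 0, so [phi' w] is a coboundary, and so is its unimodular
    coordinate, a unit multiple of [phi']. *)
Lemma koszul_vanish C P s r q (Z : 'M[A]_(r, q)) (p : {linear 'rV[A]_q -> P})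
    (w : 'rV_r) j :
  syzygy (@finite_free A) s C P -> short_exact (mulmxr Z : {linear 'rV[A]_r -> 'rV[A]_q}) p ->
  ~ m (w 0 j) -> (forall k, radical (ideal_span x) ((w *m Z) 0 k)) ->
  forall g, (g <= s)%N -> koszul_zero_at A^o g.
Proof.
move=> sP sZ wj wZ; elim/ltn_ind => g IHg gs phi c; apply: contrapT => nc.
pose ts := [seq (w *m Z) 0 k | k <- enum 'I_q].
have [|phi' [c' nc' tc']] := @killed_class ts g A^o phi _ c nc.
  by move=> t /mapP[k _ ->]; exact: wZ.
have Av k : (k < g)%N -> koszul_zero_at A^o k.
  by move=> kg; apply: IHg => //; apply: leq_trans (ltnW kg) gs.
have Pl : linear (fun z : koszul A n g => (phi' z : A) *: w).
  by move=> a u v; rewrite linearP scalerDl scalerA.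
have [u uE] : exists u, u * w 0 j = 1 by case: ml => _ _ _ _; apply.
apply: nc'; suff cP : coboundary (linear_of Pl).
  apply: coboundary_ext (coboundary_scale u (coboundary_comp (row_coord A j) cP)) => z /=.
  rewrite mxE [LHS]mulrCA uE; exact: mulr1.
apply: (coboundary_short_exact sZ) => [k kg|]; first exact: (koszul_zero_at_syzygy sP Av (leq_trans kg gs)).
apply: (@coboundary_coord _ _ (mulmxr Z \o linear_of Pl)) => k.
have kt : (w *m Z) 0 k \in ts by apply/mapP; exists k; rewrite ?mem_enum.
apply: coboundary_ext (tc' _ kt) => z /=; rewrite -scalemxAl [RHS]mxE; exact: mulrC.
Qed.

End KoszulCohomology.

(** * The weak dimension bounds the Koszul depth *)

Section KoszulUpper.
Variables (A : comNzRingType) (n : nat) (x : n.-tuple A) (m : set A) (d : nat).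
Hypotheses (ml : local_ideal m) (fd : forall M : lmodType A, flat_dim_le d M).
Implicit Types M N C K : lmodType A.

(** The pairing identifying [koszul A n i] with its own dual, hence the Koszul cochain
    complex with coefficients in [A] with a complex of finite free modules. *)
Definition kpair i (f z : koszul A n i) : A := \sum_s (f s : A) * z s.

Lemma kpair_linear i (f : koszul A n i) : linear (kpair f : koszul A n i -> A^o).
Proof.
move=> a u v; rewrite /kpair [X in _ = X + _]mulr_sumr -big_split; apply: eq_bigr => s _ /=.
by rewrite !ffunE mulrDr mulrCA.
Qed.
Definition kdual i (f : koszul A n i) : {linear koszul A n i -> A^o} :=
  linear_of (kpair_linear f).

Lemma kpairP i a (f g : koszul A n i) z :
  kpair (a *: f + g) z = a * kpair f z + kpair g z.
Proof.
rewrite /kpair mulr_sumr -big_split; apply: eq_bigr => s _ /=.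
by rewrite !ffunE mulrDl mulrA.
Qed.

Lemma kpair_base i (f : koszul A n i) s : kpair f (kbase A s) = f s.
Proof.
rewrite /kpair (bigD1 s) //= ffunE eqxx mulr1 big1 ?addr0 // => s' ss'.
by rewrite ffunE (negPf ss') mulr0.
Qed.

Lemma dual_kpair i (phi : {linear koszul A n i -> A^o}) z :
  phi z = kpair [ffun s => phi (kbase A s)] z.
Proof.
rewrite [z in LHS](koszul_basis z) linear_sum; apply: eq_bigr => s _.
by rewrite linearZ ffunE; apply: mulrC.
Qed.

Lemma kpair_eq i (f g : koszul A n i) : kpair f =1 kpair g -> f = g.
Proof. by move=> fg; apply/ffunP => s; rewrite -!kpair_base fg. Qed.

Lemma codiff_linear i : linear (fun f : koszul A n i =>
  [ffun s => kpair f (kdiff x i (kbase A s))] : koszul A n i.+1).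
Proof. by move=> a f g; apply/ffunP => s; rewrite !ffunE kpairP. Qed.
Definition codiff i : {linear koszul A n i -> koszul A n i.+1} := linear_of (@codiff_linear i).

Lemma kpair_codiff i (f : koszul A n i) z : kpair (codiff i f) z = kpair f (kdiff x i z).
Proof.
rewrite [RHS](dual_kpair (kdual f \o kdiff x i)).
by congr kpair; apply/ffunP => s; rewrite !ffunE.
Qed.

Lemma kpair0 i (z : koszul A n i) : kpair 0 z = 0.
Proof. by rewrite /kpair big1 // => s _; rewrite ffunE mul0r. Qed.

Lemma codiff_codiff i (f : koszul A n i) : codiff i.+1 (codiff i f) = 0.
Proof.
apply: kpair_eq => z; rewrite !kpair_codiff kpair0 kdiff_kdiff.
exact: (linear0 (kdual f)).
Qed.

Lemma codiff_exact i (f : koszul A n i.+1) : koszul_zero_at x A^o i.+1 ->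
  codiff i.+1 f = 0 -> exists g, codiff i g = f.
Proof.
move=> v f0; have [|psi psiE] := v (kdual f).
  by move=> z; rewrite -[LHS]/(kpair _ _) -kpair_codiff f0 kpair0.
exists [ffun s => psi (kbase A s)]; apply: kpair_eq => z.
by rewrite kpair_codiff -dual_kpair -psiE.
Qed.

Lemma codiff_exact0 (f : koszul A n 0) : koszul_zero_at x A^o 0 -> codiff 0 f = 0 -> f = 0.
Proof.
move=> v f0; apply: kpair_eq => z; rewrite kpair0; apply: (v (kdual f)) => {}z.
by rewrite -[LHS]/(kpair _ _) -kpair_codiff f0 kpair0.
Qed.

(** The exact part of the cochain complex is a finite free resolution, so that each
    cokernel in it is a high syzygy of a later one. *)
Lemma codiff_syzygy e i C (p : {linear koszul A n i.+1 -> C}) :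
  coker_of (codiff i) p -> (forall k, (k <= i + e)%N -> koszul_zero_at x A^o k) ->
  exists M, syzygy (@flat A) e M C.
Proof.
elim: e i C p => [|e IHe] i C p [po pP] v; first by exists C.
have [C' [p' [po' pP']]] := coker_exists (codiff i.+1).
have [|j jE] := factor_onto (f := codiff i.+1) po.
  by move=> y /pP[u <-]; apply: codiff_codiff.
have [|M sM] := IHe i.+1 C' p' (conj po' pP').
  by move=> k; rewrite addSnnS; apply: v.
exists M, C', (koszul A n i.+2), j, p'; split; last exact: sM.
  split=> // [|y].
    apply: lin_eq0_inj => y; have [u <-] := po y; rewrite jE => /codiff_exact[].
      by apply: v; rewrite addnS ltnS leq_addr.
    by move=> g gu; apply/pP; exists g.
  apply: iff_trans (pP' y) _; split=> [[u <-]|[c <-]].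
    by exists (p u); rewrite jE.
  by have [u <-] := po c; exists u; rewrite jE.
exact: koszul_flat.
Qed.

(** If the cohomology vanished up to degree [d], the cokernel [C] of the map from
    the degree 0 term to the degree 1 term would be a [d]-th syzygy, and
    Tor_1(C, A/m) would vanish since A/m has flat dimension at most [d].  The map would then
    stay injective modulo [m], where it is zero. *)
Lemma koszul_nonzero_below : (forall j, m (tnth x j)) ->
  exists2 i, (i <= d)%N & ~ koszul_zero_at x A^o i.
Proof.
case: (ml) => m0 mD mM m1 _ mx; apply: contrapT => nv.
have v i : (i <= d)%N -> koszul_zero_at x A^o i.
  by move=> id; apply: contrapT => nvi; apply: nv; exists i.
have cov := flat_dim_le_covers fd.
have [C [p [po pP]]] := coker_exists (codiff 0).
have [|M sM] := codiff_syzygy (e := d) (conj po pP); first by move=> k; apply: v.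
have [|I [io [ioi ioP]]] := @sub_exists A A^o m.
  split=> [|a u w]; rewrite !inE // => mu mw; apply: mD => //; exact: mM.
have [k [pr [pro prP]]] := coker_exists io.
have prm a : pr a = 0 <-> m a := iff_trans (prP a) (iff_sym (ioP a)).
have tk : tor1_zero k C by apply/(tor1_zero_sym cov)/(tor1_zero_syzygy cov _ (fd k) sM).
have s0 : short_exact (codiff 0) p.
  by split=> //; apply: lin_eq0_inj => f; apply: codiff_exact0; apply: v.
have inj := tor1_zero_inj tk s0.
have c0 : #|finset.set0 : {set 'I_n}| == 0%N by rewrite cards0.
pose s : {S : {set 'I_n} | #|S| == 0%N} :=
  exist (fun S : {set 'I_n} => #|S| == 0%N) finset.set0 c0.
have t0 : pure (pr 1) (kbase A s) = 0.
  apply: inj; rewrite linear0 tmaprE (koszul_basis (codiff 0 _)) pure_sumr big1 // => s' _.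
  rewrite pureZr -pureZl -linearZ (_ : pr _ = 0) ?pure0l //.
  apply/prm; rewrite [X in m X](_ : _ = (kcoord A s' (codiff 0 (kbase A s)) : A)); last exact: mulr1.
  rewrite /= ffunE /kpair; elim/big_ind: _ => // s'' _; apply/mM; exact: (kdiff_ideal (kbase A s') s'' m0 mD mM mx).
have bb : bilinear_map (fun (c : k) (f : koszul A n 0) => (f s : A) *: c).
  split=> [f a u w|c a u w]; first by rewrite scalerDr !scalerA mulrC.
  by rewrite !ffunE scalerDl -scalerA.
have : pr 1 = 0.
  by rewrite -(linear0 (tlift bb)) -t0 tlift_pure ffunE eqxx scale1r.
by move/prm.
Qed.

End KoszulUpper.

(** * Prime chains and generation up to radical *)

Section Primes.
Variable A : comNzRingType.
Implicit Types (I J P Q S : set A) (a b c u w : A).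

Definition is_ideal I := [/\ I 0, forall a b, I a -> I b -> I (a + b)
  & forall a b, I b -> I (a * b)].

Lemma idealr_closedP I : idealr_closed (mem I) <-> is_ideal I /\ ~ I 1.
Proof.
split=> [[I0 I1 IM]|[[I0 ID IM] I1]].
  have I0' : I 0 by have := I0; rewrite inE.
  have IM' a b c : I b -> I c -> I (a * b + c).
    by move=> Ib Ic; have := IM a b c; rewrite !inE; apply.
  split; last by move=> i1; move/negP: I1; apply; rewrite inE.
  split=> // a b; first by move=> Ia Ib; rewrite -[a]mul1r; apply: (IM').
  by move=> Ib; rewrite -[_ * _]addr0; apply: (IM').
split; rewrite ?inE //; first by apply/negP; rewrite inE.
by move=> a b c; rewrite !inE => Ib Ic; apply: (ID) => //; apply: (IM).
Qed.

Lemma prime_idealP P : prime_ideal P <->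
  [/\ is_ideal P, ~ P 1 & forall a b, P (a * b) -> P a \/ P b].
Proof.
split=> [[/idealr_closedP[iP P1] pP]|[iP P1 pP]].
  by split=> // a b ab; have := pP a b; rewrite !inE => /(_ ab)/orP[]; rewrite inE; auto.
split; first exact/idealr_closedP.
by move=> a b; rewrite !inE => /pP[] h; apply/orP; rewrite !inE; auto.
Qed.

(** Zorn's lemma, applied to the sets whose union with [J] is an ideal, so that the
    union of the empty chain is admissible. *)
Lemma max_avoiding J S : is_ideal J -> (forall a, J a -> ~ S a) ->
  exists P, [/\ is_ideal P, J `<=` P, forall a, P a -> ~ S a &
    forall Q, is_ideal Q -> P `<=` Q -> (forall a, Q a -> ~ S a) -> Q `<=` P].
Proof.
move=> [J0 JD JM] JS.
pose good X := is_ideal (X `|` J) /\ forall a, X a -> ~ S a.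
have [F Fgood Ftot|X [[iX XS] Xmax]] := @Zorn_bigcup A good.
  split; last by move=> a [X FX Xa]; have [_] := Fgood _ FX; apply.
  split=> [|a b|a b].
  - by right.
  - move=> [[X FX Xa]|Ja] [[Y FY Yb]|Jb].
    + have [XY|YX] := Ftot _ _ FX FY.
        have [[_ + _] _] := Fgood _ FY; move/(_ a b (or_introl (XY _ Xa)) (or_introl Yb)).
        by case=> h; [left; exists Y|right].
      have [[_ + _] _] := Fgood _ FX; move/(_ a b (or_introl Xa) (or_introl (YX _ Yb))).
      by case=> h; [left; exists X|right].
    + have [[_ + _] _] := Fgood _ FX; move/(_ a b (or_introl Xa) (or_intror Jb)).
      by case=> h; [left; exists X|right].
    + have [[_ + _] _] := Fgood _ FY; move/(_ a b (or_intror Ja) (or_introl Yb)).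
      by case=> h; [left; exists Y|right].
    + by right; apply: (JD).
  - move=> [[X FX Xb]|Jb]; last by right; apply: (JM).
    have [[_ _ +] _] := Fgood _ FX; move/(_ a b (or_introl Xb)).
    by case=> h; [left; exists X|right].
exists (X `|` J); split=> // [a|Q iQ XQ QS].
- by case; [apply: XS|apply: JS].
- have QJ : Q `|` J = Q by apply/setUidPl => a Ja; apply: XQ; right.
  apply: contrapT => nQ; apply: (Xmax Q); last by split; rewrite ?QJ.
  split; last by move=> QX; apply: nQ => a /QX; left.
  by move=> a Xa; apply: XQ; left.
Qed.

Definition adjoin I a : set A := [set b | exists i c, I i /\ b = i + c * a].

Lemma adjoin_ideal I a : is_ideal I -> is_ideal (adjoin I a).
Proof.
move=> [I0 ID IM]; split.
- by exists 0, 0; rewrite mul0r addr0.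
- move=> _ _ [i [c [Ii ->]]] [i' [c' [Ii' ->]]]; exists (i + i'), (c + c').
  by split; [exact: ID|rewrite mulrDl addrACA].
- move=> b _ [i [c [Ii ->]]]; exists (b * i), (b * c).
  by split; [exact: IM|rewrite mulrDr mulrA].
Qed.

Lemma prime_avoiding J S : is_ideal J -> S 1 -> (forall a b, S a -> S b -> S (a * b)) ->
  (forall a, J a -> ~ S a) ->
  exists P, [/\ prime_ideal P, J `<=` P & forall a, P a -> ~ S a].
Proof.
move=> iJ S1 SM /(max_avoiding iJ)[P [iP JP PS Pmax]]; exists P; split=> //.
have [P0 PD PM] := iP.
apply/prime_idealP; split=> //; first by move/PS.
have key a : ~ P a -> exists i c, P i /\ S (i + c * a).
  move=> nPa; apply: contrapT => ne; apply: nPa.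
  apply: (Pmax (adjoin P a)); first exact: adjoin_ideal.
  - by move=> b Pb; exists b, 0; rewrite mul0r addr0.
  - by move=> _ [i [c [Pi ->]]] s; apply: ne; exists i, c.
  - by exists 0, 1; rewrite mul1r add0r.
move=> a b Pab; apply: contrapT => /not_orP[/key[i [c [Pi s]]] /key[j [e [Pj t]]]].
have := SM _ _ s t; apply: PS; rewrite mulrDl; apply: (PD).
  by rewrite mulrC; apply: (PM).
rewrite mulrDr; apply: (PD); first exact: PM.
by rewrite mulrACA; apply: (PM).
Qed.

Lemma prime_pow P a k : prime_ideal P -> P (a ^+ k) -> P a.
Proof.
move=> /prime_idealP[_ P1 Pp]; elim: k => [/P1|k IHk] //.
by rewrite exprS => /Pp[].
Qed.

Lemma radical_prime J a : is_ideal J ->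
  (forall P, prime_ideal P -> J `<=` P -> P a) -> radical J a.
Proof.
move=> iJ Ja; apply: contrapT => na.
have [||b Jb [k bE]|P [pP JP PS]] := @prime_avoiding J [set b | exists k, b = a ^+ k] iJ.
- by exists 0%N.
- by move=> _ _ [k ->] [l ->]; exists (k + l)%N; rewrite exprD.
- by apply: na; exists k; rewrite -bE.
- by apply: (PS a (Ja P pP JP)); exists 1%N.
Qed.

Definition family_ideal J n (b : 'I_n -> A) : set A :=
  [set a | exists j (c : 'I_n -> A), J j /\ a = j + \sum_i c i * b i].

Lemma family_ideal_ideal J n (b : 'I_n -> A) : is_ideal J -> is_ideal (family_ideal J b).
Proof.
move=> [J0 JD JM]; split.
- by exists 0, (fun=> 0); rewrite big1 ?addr0 // => i _; rewrite mul0r.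
- move=> _ _ [i [c [Ji ->]]] [i' [c' [Ji' ->]]]; exists (i + i'), (fun k => c k + c' k).
  split; first exact: JD.
  by under [in RHS]eq_bigr do rewrite mulrDl; rewrite big_split addrACA.
- move=> a _ [i [c [Ji ->]]]; exists (a * i), (fun k => a * c k).
  split; first exact: JM.
  by rewrite mulrDr mulr_sumr; congr (_ + _); apply: eq_bigr => k _; rewrite mulrA.
Qed.

Lemma family_ideal_sub J n (b : 'I_n -> A) : J `<=` family_ideal J b.
Proof.
move=> a Ja; exists a, (fun=> 0); split=> //.
by rewrite big1 ?addr0 // => i _; rewrite mul0r.
Qed.

Lemma family_ideal_mem J n (b : 'I_n -> A) i : J 0 -> family_ideal J b (b i).
Proof.
move=> J0; exists 0, (fun k => (k == i)%:R); split=> //.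
rewrite (bigD1 i) //= eqxx mul1r big1 ?addr0 ?add0r // => k /negPf ->.
by rewrite mul0r.
Qed.

Definition prime_chain n (p : nat -> set A) :=
  (forall i, (i <= n)%N -> prime_ideal (p i)) /\
  (forall i, (i < n)%N -> p i `<` p i.+1).

(** Kronecker's theorem on the number of generators up to radical, for the primes
    that contain [J] and avoid [u].  Induction on [n]: let [J'] be generated by [J], [b0]
    and the elements [w] with [w b0^k] in [J] for some [k].  A prime [p 0] containing
    [J'] is not minimal over [J], so chains over [J'] are shorter, and the induction
    hypothesis applies to [J'] and the remaining [b i].  The element [w] occurring in the
    resulting relation is the correction for [b0]: a prime containing [J] and
    [b0 + u w] contains [w] or [b0], hence both of them or [u]. *)
Lemma kronecker n J u : is_ideal J ->
  (forall p, prime_chain n p -> J `<=` p 0%N -> p n u) ->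
  forall b : 'I_n -> A, exists w : 'I_n -> A,
    radical (family_ideal J (fun i => b i + u * w i)) u.
Proof.
elim: n J => [|n IHn] J iJ noc b.
  exists (fun=> 0); apply: radical_prime => [|P pP JP]; first exact: family_ideal_ideal.
  apply: (noc (fun=> P)); first by split.
  by move=> a Ja; apply/JP/family_ideal_sub.
have [J0 JD JM] := iJ.
pose b0 := b ord0.
pose J' := [set a | exists j c w k, [/\ J j, J (w * b0 ^+ k) & a = j + c * b0 + w]].
have iJ' : is_ideal J'.
  split.
  - by exists 0, 0, 0, 0%N; split; rewrite ?mul0r ?addr0.
  - move=> _ _ [j [c [w [k [Jj Jw ->]]]]] [j' [c' [w' [k' [Jj' Jw' ->]]]]].
    exists (j + j'), (c + c'), (w + w'), (k + k')%N; split; first exact: JD.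
      rewrite mulrDl exprD; apply: (JD); first by rewrite mulrA mulrC; apply: (JM).
      by rewrite mulrCA; apply: (JM).
    by rewrite mulrDl addrACA [X in X + _ = _]addrACA.
  - move=> a _ [j [c [w [k [Jj Jw ->]]]]]; exists (a * j), (a * c), (a * w), k.
    by split; rewrite -?mulrA; [exact: JM|exact: JM|rewrite !mulrDr mulrA].
have [p [pp ps] J'p|w' [k [j' [c [[j [e [w [l [Jj Jw ->]]]]]]] uE]]] :=
    IHn J' iJ' _ (fun i => b (lift ord0 i)).
  have /prime_idealP[[p00 p0D p0M] p01 p0p] := pp 0%N isT.
  have b0p : p 0%N b0.
    by apply: J'p; exists 0, 1, 0, 0%N; split; rewrite ?mul0r ?mul1r ?addr0 ?add0r.
  have Wp v r : J (v * b0 ^+ r) -> p 0%N v.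
    by move=> Jv; apply: J'p; exists 0, 0, v, r; split; rewrite ?mul0r ?add0r ?addr0.
  have [||a Ja [v [r [npv aE]]]|q [pq Jq qS]] :=
      @prime_avoiding J [set a | exists v r, ~ p 0%N v /\ a = v * b0 ^+ r] iJ.
  - by exists 1, 0%N; rewrite mul1r.
  - move=> _ _ [v [r [npv ->]]] [v' [r' [npv' ->]]]; exists (v * v'), (r + r')%N.
    by split; [move/p0p=> []|rewrite exprD mulrACA].
  - by apply: npv; apply: (Wp v r); rewrite -aE.
  (* [q] lies strictly below [p 0]: it avoids [b0] and everything outside [p 0]. *)
  apply: (noc (fun i => if i is i'.+1 then p i' else q)) => //.
  split=> [[|i] //|[|i] //= ni]; last exact: ps.
  + exact: pp.
  + split=> [a qa|pq'].
      by apply: contrapT => npa; apply: (qS a qa); exists a, 0%N; rewrite mulr1.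
    by apply: (qS b0 (pq' _ b0p)); exists 1, 1%N; rewrite mul1r.
exists (fun i => if unlift ord0 i is Some i' then w' i' else w).
apply: radical_prime => [|P pP IP]; first exact: family_ideal_ideal.
have /prime_idealP[[P0 PD PM] P1 Pp] := pP.
have JP : J `<=` P by move=> a Ja; apply/IP/family_ideal_sub.
have Pb0 : P (b0 + u * w).
  by apply: IP; have := @family_ideal_mem J _ (fun i => b i + u * if unlift ord0 i is Some i' then w' i' else w) ord0 J0; rewrite unlift_none.
have Pb i : P (b (lift ord0 i) + u * w' i).
  by apply: IP; have := @family_ideal_mem J _ (fun i => b i + u * if unlift ord0 i is Some i' then w' i' else w) (lift ord0 i) J0; rewrite liftK.
have PB a a' : P (a + a') -> P a' -> P a.
  by move=> h h'; rewrite -[a](addrK a') -mulN1r; apply: (PD) => //; apply: (PM).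
apply: contrapT => nPu.
have Pw : P w.
  have [//|Pb0'] := Pp _ _ (JP _ Jw).
  have : P (u * w).
    by apply: (PB _ b0); [rewrite addrC|exact: prime_pow Pb0'].
  by case/Pp.
have Pb0' : P b0 by apply: (PB) Pb0 _; apply: (PM).
apply/nPu/(prime_pow (k := k) pP); rewrite uE; apply: (PD).
  by apply: (PD) => //; apply: (PD); [exact: JP|exact: PM].
by elim/big_ind: _ => // i _; apply: (PM).
Qed.

(** A nonunit generates a proper ideal, which lies in some maximal ideal, that is,
    in [m]. *)
Lemma quasilocal_local (m : set A) : quasilocal m -> local_ideal m.
Proof.
move=> [[/idealr_closedP[[m0 mD mM] m1] mmax] muniq]; split=> // a nma.
apply: contrapT => nU.
have iJ : is_ideal (adjoin (fun x => x = 0) a).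
  apply: adjoin_ideal; split=> // [x y -> ->|x y ->]; first by rewrite addr0.
  by rewrite mulr0.
have [|P [iP JP P1 Pmax]] := @max_avoiding _ (fun x => x = 1) iJ.
  by move=> _ [i [c [-> ->]]]; rewrite add0r => ca; apply: nU; exists c.
have nP1 : ~ P 1 by move=> /P1.
apply: nma; rewrite -(muniq P); first by apply: JP; exists 0, 1; rewrite mul1r add0r.
split; first exact/idealr_closedP.
move=> Q /idealr_closedP[iQ Q1] PQ; apply/seteqP; split=> //.
by apply: Pmax => // x Qx x1; apply: Q1; rewrite -x1.
Qed.

Variable m : set A.
Hypothesis ml : local_ideal m.

Lemma local_prime : prime_ideal m.
Proof.
case: ml => m0 mD mM m1 mU; apply/prime_idealP; split=> // a b mab.
apply: contrapT => /not_orP[/mU[a' a'E] /mU[b' b'E]]; apply: m1.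
by rewrite -[1]mulr1 -[in X in X * _]a'E -b'E mulrACA; apply: (mM).
Qed.

Lemma local_contains P : prime_ideal P -> P `<=` m.
Proof.
case: ml => m0 mD mM m1 mU /prime_idealP[[P0 PD PM] P1 _] a Pa.
by apply: contrapT => /mU[b bE]; apply: P1; rewrite -bE; apply: (PM).
Qed.

(** A prime that avoids an element of [m] is different from [m], so chains of such primes
    can be extended by [m]; this saves one generator in Kronecker's theorem.  The
    elements of [ts] are absorbed one at a time. *)
Lemma radical_generation n (ts : seq A) : (forall p, ~ prime_chain n.+1 p) ->
  (forall t, t \in ts -> m t) ->
  exists y : n.-tuple A, (forall j, m (tnth y j)) /\
    forall t, t \in ts -> radical (ideal_span y) t.
Proof.
case: (ml) => m0 mD mM m1 mU noc; elim: ts => [|t ts IHts] tm.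
  by exists [tuple 0 | _ < n]; split=> // j; rewrite tnth_mktuple.
have [|y [my yt]] := IHts; first by move=> s ts'; apply: tm; rewrite inE ts' orbT.
have mt : m t by apply: tm; rewrite inE eqxx.
(* The zero ideal, so that the chain condition is about all primes. *)
pose Z : set A := fun x => x = 0.
have iZ : is_ideal Z by split=> // [x y' -> ->|x y' ->]; rewrite ?addr0 ?mulr0.
have [|w [k wt]] := @kronecker n Z t iZ _ (tnth y).
  move=> p [pp ps] _; apply: contrapT => npt.
  apply: (noc (fun i => if (i <= n)%N then p i else m)); split=> i ni.
    by case: ifP => [/pp//|_]; exact: local_prime.
  rewrite -ltnS ni; have [ni'|ni'] := ltnP i n; first exact: ps.
  have -> : i = n by apply/eqP; rewrite eqn_leq -ltnS ni.
  by split=> [|mp]; [exact/local_contains/pp|apply/npt/mp].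
pose y' := [tuple tnth y i + t * w i | i < n].
have spanE a : family_ideal Z (fun i => tnth y i + t * w i) a <-> ideal_span y' a.
  split=> [[j [c [-> ->]]]|[c ->]]; [exists c|exists 0, c; split=> //]; rewrite add0r;
    by apply: eq_bigr => i _; rewrite tnth_mktuple.
exists y'; split=> [j|s]; first by rewrite tnth_mktuple; apply: (mD) => //; rewrite mulrC; apply: (mM).
have rt : radical (ideal_span y') t by exists k; apply/spanE.
rewrite inE => /predU1P[-> //|/yt[l [c sE]]].
have [||l' /spanE sl'] := @radical_prime (family_ideal Z (fun i => tnth y i + t * w i)) s.
- exact: family_ideal_ideal.
- move=> P pP IP; have /prime_idealP[[P0 PD PM] P1 Pp] := pP.
  have Pt : P t by apply: (prime_pow (k := k) pP); apply: IP.
  apply: (prime_pow (k := l) pP); rewrite sE; elim/big_ind: _ => // i _; apply: (PM).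
  rewrite -[tnth y i](addrK (t * w i)); apply: (PD).
    by apply: IP; apply: (@family_ideal_mem Z _ (fun i => tnth y i + t * w i)).
  by rewrite -mulrN mulrC; apply: (PM).
- by exists l'.
Qed.

End Primes.

(** * Weak dimension, Koszul depth, Krull dimension and arithmetic rank *)

Lemma dim_of_nat_le a b : (dim_of_nat a <= dim_of_nat b)%E = (a <= b)%N.
Proof. by rewrite lee_fin ler_nat. Qed.

Lemma dim_of_nat_lt a b : (dim_of_nat a < dim_of_nat b)%E = (a < b)%N.
Proof. by rewrite lte_fin ltr_nat. Qed.

Lemma dim_inf_le (S : set nat) k : S k -> (dim_inf S <= dim_of_nat k)%E.
Proof. by move=> Sk; apply: ereal_inf_lbound; exists k. Qed.

Lemma le_dim_inf (S : set nat) k :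
  (forall n, S n -> (k <= n)%N) -> (dim_of_nat k <= dim_inf S)%E.
Proof.
by move=> Sk; apply: le_ereal_inf_tmp => _ [n Sn <-]; rewrite dim_of_nat_le; exact: Sk.
Qed.

(** A finite weak dimension is a natural number: it bounds the flat dimensions by
    some integer, and the least uniform bound is attained. *)
Lemma wdim_nat (A : comNzRingType) : (wdim A < +oo)%E -> exists d,
  [/\ wdim A = dim_of_nat d, forall M : lmodType A, flat_dim_le d M &
      forall e, d = e.+1 -> exists M : lmodType A, ~ flat_dim_le e M].
Proof.
move=> fin.
have [N ltN] : exists N, (wdim A < dim_of_nat N)%E.
  case: (wdim A) fin => [r _||_]; rewrite ?ltxx //; last by exists 0%N; exact: ltNyr.
  by exists (Num.trunc r).+1; rewrite lte_fin truncnS_gt.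
have bound M k : (flat_dim M < dim_of_nat k.+1)%E -> flat_dim_le k M.
  move=> /ereal_inf_lt[_ [n Mn <-]]; rewrite dim_of_nat_lt ltnS => nk.
  exact: flat_dim_leW nk (resolution_flat_dim_le Mn).
have ex : exists d, `[< forall M : lmodType A, flat_dim_le d M >].
  exists N; apply/asboolP => M; apply: bound.
  apply: le_lt_trans (_ : (_ <= wdim A)%E) (lt_trans ltN _); last by rewrite dim_of_nat_lt.
  by apply: ereal_sup_ubound; exists M.
case: (ex_minnP ex) => d /asboolP dM dmin; exists d.
have dE e : d = e.+1 -> exists M : lmodType A, ~ flat_dim_le e M.
  move=> de; apply: contrapT => ne; have := dmin e; rewrite de ltnn => /(_ _)/negP.
  apply; rewrite ?de //; apply/asboolP => M; apply: contrapT => nM; apply: ne.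
  by exists M.
split=> //; apply/eqP; rewrite eq_le; apply/andP; split.
  apply: ge_ereal_sup => _ [M ->]; apply: dim_inf_le; exact: flat_dim_le_resolution.
case: d {dmin} dM dE => [|e] dM dE.
  apply: le_trans (_ : (_ <= flat_dim (A^o : lmodType A))%E) _.
    exact: le_dim_inf.
  by apply: ereal_sup_ubound; exists A^o.
have [M nM] := dE e erefl.
apply: le_trans (_ : (_ <= flat_dim M)%E) _; last by apply: ereal_sup_ubound; exists M.
rewrite leNgt; apply/negP => /bound; exact: nM.
Qed.

Lemma syzygy_free_flat (A : comNzRingType) n (C P : lmodType A) :
  syzygy (@finite_free A) n C P -> syzygy (@flat A) n C P.
Proof.
elim: n P => //= n IHn P [Q [F [i [p [sip /finite_free_flat Ff /IHn sQ]]]]].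
by exists Q, F, i, p.
Qed.

(** The [n]-th syzygy of any module is Tor_1-orthogonal to the finitely presented
    modules, hence flat. *)
Lemma flat_dim_le_fin_pres (A : comNzRingType) n (M : lmodType A) :
  has_flat_covers A -> (forall C : lmodType A, fin_pres C -> flat_dim_le n C) -> flat_dim_le n M.
Proof.
move=> cov fpn; have [K sK] := flat_syzygy_exists cov n M.
apply: (syzygy_flat_dim_le sK); apply: flat_fin_pres => C /fpn Cn.
exact: (tor1_zero_syzygy cov (fun _ h => h) Cn sK).
Qed.

(** The vector [t] witnesses that the last map of a finite free resolution of length
    [d] does not split modulo [m].  Every Koszul complex on elements that generate
    the coordinates of [t] up to radical is acyclic below degree [d]; this bounds [d]
    by the Koszul depth, the Krull dimension and the arithmetic rank. *)
Lemma test_vector (A : comNzRingType) (m : set A) d :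
  local_ideal m -> coherent A -> (forall M : lmodType A, flat_dim_le d M) ->
  (forall e, d = e.+1 -> exists M : lmodType A, ~ flat_dim_le e M) ->
  exists q (t : 'rV[A]_q), (forall k, m (t 0 k)) /\
    forall n (x : n.-tuple A), (forall k, radical (ideal_span x) (t 0 k)) ->
      forall g, (g < d)%N -> koszul_zero_at x A^o g.
Proof.
move=> ml coh; case: d => [|e] dM dmin; first by exists 0%N, 0; split=> // -[].
have cov := flat_dim_le_covers dM; have [M nM] := dmin e erefl.
have [C [fC nC]] : exists C : lmodType A, fin_pres C /\ ~ flat_dim_le e C.
  apply: contrapT => ne; apply: nM; apply: flat_dim_le_fin_pres => // C fC.
  by apply: contrapT => nC; apply: ne; exists C.
have [P [sP fP]] := fin_pres_syzygies e coh fC.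
have nP : ~ flat P by move=> Pf; apply: nC; apply: syzygy_flat_dim_le Pf; exact: syzygy_free_flat.
have [q [T [i [p [sip fT]]]]] := fin_pres_syzygy coh fP.
have sT : syzygy (@finite_free A) e.+1 C T.
  by exists P, ('rV[A]_q : lmodType A), i, p; split=> //; exists q.
have Tf : flat T.
  apply: (flat_tor1_zero cov) => N; apply: (tor1_zero_sym cov).
  exact: (tor1_zero_syzygy cov (@finite_free_flat A) (dM N) sT).
have [r0 [r [_ [g0 [g0o _]]]]] := fT.
have [s [g [gi go]]] := fg_flat_free ml g0o Tf.
pose Z := lin1_mx (i \o g).
have ZE v : v *m Z = i (g v) by rewrite mul_rV_lin1.
have [ii po pP] := sip.
have ker v : p v = 0 <-> exists u, mulmxr Z u = v.
  apply: iff_trans (pP v) _; split=> [[k <-]|[u <-]].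
    by have [u <-] := go k; exists u; rewrite /= ZE.
  by exists (g u); rewrite /= ZE.
have sZ : short_exact (mulmxr Z : {linear 'rV[A]_s -> 'rV[A]_q}) p.
  by split=> // u v; rewrite /= !ZE => /ii/gi.
have [w [j [wj wZ]]] := coker_not_flat ml (conj po ker) nP.
exists q, (w *m Z); split=> // n x xt k; rewrite ltnS.
exact: (koszul_vanish ml sP sZ wj xt).
Qed.

Unset Implicit Arguments.

Theorem mainTheorem2 (A : comNzRingType) (m : set A) :
  quasilocal m ->
  coherent A ->
  (wdim A < +oo)%E ->
  [/\ Kdepth m = wdim A,
      (wdim A <= krull_dim A)%E &
      (wdim A <= ara m)%E].
Proof.
move=> /quasilocal_local ml coh /wdim_nat[d [-> dM dmin]].
have [q [t [mt tP]]] := test_vector ml coh dM dmin.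
have [m0 mD mM m1 mU] := ml.
have msum n (x : n.-tuple A) : (forall j, m (tnth x j)) -> ideal_span x `<=` m.
  by move=> mx _ [c ->]; elim/big_ind: _ => // j _; apply: mM.
have spanx n (x : n.-tuple A) j : ideal_span x (tnth x j).
  exists (fun k => (k == j)%:R); rewrite (bigD1 j) //= eqxx mul1r big1 ?addr0 //.
  by move=> k /negPf ->; rewrite mul0r.
split.
- apply/eqP; rewrite eq_le; apply/andP; split.
    apply: ge_ereal_sup => _ [n [x [xm ->]]].
    have [|i id ni] := koszul_nonzero_below (x := x) ml dM; first by move=> j; exact/xm/spanx.
    apply: le_trans (dim_inf_le _) _; first exact/koszul_zero_atP/ni.
    by rewrite dim_of_nat_le.
  pose x := [tuple t 0 k | k < q].
  apply: le_trans (_ : (_ <= Kgrade_fg x (A^o : lmodType A))%E) _.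
    apply: le_dim_inf => n /koszul_zero_atP nv; rewrite leqNgt; apply/negP => nd.
    apply: nv; apply: tP nd => k; exists 1%N; rewrite expr1.
    by have := spanx _ x k; rewrite tnth_mktuple.
  apply: ereal_sup_ubound; exists q, x; split=> //.
  by apply: msum => j; rewrite tnth_mktuple.
- have [p pd] : exists p : nat -> set A, prime_chain d p.
    case: d {dM dmin} tP => [|e] tP.
      by exists (fun=> m); split=> // i _; exact: local_prime.
    apply: contrapT => noc.
    have [p pe|s|y [my ty]] := radical_generation (n := e) (ts := [seq t 0 k | k <- enum 'I_q]) ml.
    + by apply: noc; exists p.
    + by case/mapP=> k _ ->.
    apply: (koszul_top_nonzero ml my); apply: tP => // k; apply: ty.
    by apply/mapP; exists k; rewrite ?mem_enum.
  by apply: ereal_sup_ubound; exists d => //; exists p.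
- apply: le_dim_inf => n [x xm]; rewrite leqNgt; apply/negP => nd.
  apply: (koszul_top_nonzero (x := x) ml).
    move=> j; have [k] : radical m (tnth x j).
      by rewrite -xm; exists 1%N; rewrite expr1; exact: spanx.
    exact: prime_pow (local_prime ml).
  by apply: tP nd => k; rewrite xm; exists 1%N; rewrite expr1.
Qed.
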